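(* Assume $\sup_{x\in\mathcal X}\|x\|\le R_x$, and let $$R(t)=\max_{j\in[J]}\left\|\begin{bmatrix}\mathbf A_j^\top&\mathbf b_j\\ \bar{\mathbf a}_j^\top&\bar b_j\end{bmatrix}\right\|_{\mathrm{op}}\sqrt{t^2+1}\,\sqrt{R_x^2+1},\qquad t>0.$$ There is an absolute constant $C>0$ such that for all $J,M\ge2$ and $\tau\in(0,1)$, setting $t_M=K_{\mathrm{sw}}(\log M)^{1/\vartheta}$ and $$\eta_M=C\,R(t_M)\sqrt{\frac{J\log J(\log M)^3}{M}}+2(c_1+c_2\sqrt\Omega)\sqrt{\frac1{2M}\log\frac1\tau}+\frac{4c_1}{M}+2c_2\sqrt{\frac{2\Omega}{M}},$$ one has $\mathcal P'^M_\epsilon\subseteq\mathcal P'_{\epsilon,M}(\eta_M)$ with probability at least $1-\tau$.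
   Context: $\mathcal X\subseteq\mathbb R^{D_x}$ is compact and convex and $\Xi=\mathbb R^{D_\xi}$; $\mathscr P(\Xi)$ is the set of probability distributions on $\Xi$. The loss is $\ell(x,\xi)=\max_{j\in[J]}\big(a_j(x)^\top\xi+b_j(x)\big)$ with $a_j(x)=\mathbf A_jx+\bar{\mathbf a}_j$, $b_j(x)=\mathbf b_j^\top x+\bar b_j$; $c_1,c_2\ge0$ satisfy $|\ell(x,\xi)|\le c_1+c_2\|\xi\|$ for all $x\in\mathcal X$, $\xi\in\Xi$. $K_{\mathrm{sw}},\vartheta>0$ are constants such that the true distribution satisfies $\mathbb P^\star(\|\xi\|\le t)\ge1-2\exp(-(t/K_{\mathrm{sw}})^\vartheta)$ for all $t>0$. $\hat{\mathbb P}_N$ is the empirical reference distribution; $\Omega$ satisfies $\mathbb E_{\hat{\mathbb P}_N}[\|\xi\|^2]<\Omega$ and $\mathbb E_{\mathbb P^\star}[\|\xi\|^2]\le\Omega$; $\epsilon\ge0$. $\mathbb Z$ is a probability distribution with full support on $\mathcal X$ and $z_1,\dots,z_M$ are i.i.d. from $\mathbb Z$ (probability refers to these samples). $[u]_+=\max\{u,0\}$. The sampled set with threshold $t_M$ is $$\mathcal P'^M_\epsilon=\Big\{\mathbb Q\in\mathscr P(\Xi):\tfrac1M\sum_{m\in[M]}\big[\mathbb E_{\mathbb Q}[\ell(z_m,\xi)]-\mathbb E_{\hat{\mathbb P}_N}[\ell(z_m,\xi)]-\epsilon\big]_+\le0,\ \mathbb E_{\mathbb Q}[\|\xi\|^2]\le\Omega,\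 \mathbb Q(\|\xi\|\le t_M)\ge1-2e^{-(t_M/K_{\mathrm{sw}})^\vartheta}\Big\},$$ and for $\eta>0$ $$\mathcal P'_{\epsilon,M}(\eta)=\Big\{\mathbb Q\in\mathscr P(\Xi):\mathbb E_{z\sim\mathbb Z}\big[\big[\mathbb E_{\mathbb Q}[\ell(z,\xi)]-\mathbb E_{\hat{\mathbb P}_N}[\ell(z,\xi)]-\epsilon\big]_+\big]\le\eta,\ \mathbb E_{\mathbb Q}[\|\xi\|^2]\le\Omega,\ \mathbb Q(\|\xi\|\le t_M)\ge1-2e^{-(t_M/K_{\mathrm{sw}})^\vartheta}\Big\}.$$ *)

(* Defs.v *)
From HB Require Import structures.
From mathcomp Require Import all_boot all_order all_algebra.
From mathcomp Require Import all_classical all_reals all_analysis.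

Set Implicit Arguments.
Unset Strict Implicit.
Unset Printing Implicit Defensive.

Import Order.TTheory GRing.Theory Num.Theory.
Import numFieldNormedType.Exports.

Local Open Scope classical_set_scope.
Local Open Scope ring_scope.

(* R^n with its Borel sigma-algebra; the library topology on matrices is the
   product topology. *)
Definition vec (R : realType) (n : nat) := g_sigma_algebraType (@open 'cV[R]_n).

(* The library norm on matrices is the max norm, so the Euclidean norm and the
   operator norm it induces are defined here. *)
Definition enorm (R : realType) (n : nat) (x : 'cV[R]_n) : R :=
  Num.sqrt (\sum_i x i ord0 ^+ 2).

Definition opnorm (R : realType) (m n : nat) (B : 'M[R]_(m, n)) : R :=
  sup [set enorm (B *m v) | v in [set v : 'cV[R]_n | enorm v <= 1]].

(* For J > 0 this is the maximum: the supremum of a finite nonempty set. *)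
Definition ord_maxr (R : realType) (J : nat) (f : 'I_J -> R) : R :=
  sup (range f).

Definition pos_part (R : realType) (u : R) : R := Num.max u 0.

Record pwa (R : realType) (J Dx Dxi : nat) := PWA {
  pwA : 'I_J -> 'M[R]_(Dxi, Dx);
  pwabar : 'I_J -> 'cV[R]_Dxi;
  pwb : 'I_J -> 'cV[R]_Dx;
  pwbbar : 'I_J -> R }.

Section loss.
Context (R : realType) (J Dx Dxi : nat) (L : pwa R J Dx Dxi).

Definition pwa_slope (j : 'I_J) (x : 'cV[R]_Dx) : 'cV[R]_Dxi :=
  pwA L j *m x + pwabar L j.

Definition pwa_offset (j : 'I_J) (x : 'cV[R]_Dx) : R :=
  ((pwb L j)^T *m x) ord0 ord0 + pwbbar L j.

Definition loss (x : 'cV[R]_Dx) (xi : 'cV[R]_Dxi) : R :=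
  ord_maxr (fun j => ((pwa_slope j x)^T *m xi) ord0 ord0 + pwa_offset j x).

Definition pwa_block (j : 'I_J) : 'M[R]_(Dx + 1, Dxi + 1) :=
  block_mx (pwA L j)^T (pwb L j) (pwabar L j)^T (pwbbar L j)%:M.

Definition loss_radius (Rx t : R) : R :=
  ord_maxr (fun j => opnorm (pwa_block j)) *
  Num.sqrt (t ^+ 2 + 1) * Num.sqrt (Rx ^+ 2 + 1).

End loss.

Section distributions.
Local Open Scope ereal_scope.
Context (R : realType).

Definition second_moment (n : nat) (Q : probability (vec R n) R) : \bar R :=
  'E_Q[fun xi : vec R n => (enorm xi ^+ 2)%R].

Definition tail_bound (n : nat) (Ksw theta : R) (Q : probability (vec R n) R)
    (t : R) : Prop :=
  (1 - 2 * expR (- ((t / Ksw) `^ theta)))%:E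
    <= Q [set xi : vec R n | (enorm xi <= t)%R].

Definition is_empirical (n N : nat) (xihat : 'I_N -> vec R n)
    (P : probability (vec R n) R) : Prop :=
  forall A : set (vec R n), measurable A ->
    P A = (N%:R^-1)%:E * \sum_(i < N) \d_(xihat i) A.

Definition full_support_on (n : nat) (X : set 'cV[R]_n)
    (Z : probability (vec R n) R) : Prop :=
  Z X = 1 /\
  forall U : set 'cV[R]_n, open U -> U `&` X !=set0 -> 0 < Z U.

Definition iid_from (d : measure_display) (T : measurableType d)
    (P : probability T R) (n M : nat) (z : 'I_M -> {RV P >-> vec R n})
    (Z : probability (vec R n) R) : Prop :=
  (forall m (A : set (vec R n)), measurable A -> distribution P (z m) A = Z A) /\
  (forall (S : {set 'I_M}) (A : 'I_M -> set (vec R n)),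
     (forall m, measurable (A m)) ->
     P [set w | forall m, m \in S -> A m (z m w)] =
       \prod_(m in S) P (z m @^-1` A m)).

End distributions.

Section ambiguity_sets.
Context (R : realType) (J Dx Dxi : nat) (L : pwa R J Dx Dxi)
  (Phat : probability (vec R Dxi) R) (Om eps Ksw theta t : R).

(* Under a finite second moment the expectations below are finite, so fine
   loses nothing in the two sets defined from it. *)
Definition excess_loss (Q : probability (vec R Dxi) R) (x : 'cV[R]_Dx) : R :=
  pos_part (fine 'E_Q[loss L x] - fine 'E_Phat[loss L x] - eps).

Definition sampled_set (M : nat) (z : 'I_M -> 'cV[R]_Dx) :
    set (probability (vec R Dxi) R) :=
  [set Q | [/\ M%:R^-1 * (\sum_(m < M) excess_loss Q (z m)) <= 0,
               (second_moment Q <= Om%:E)%E &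
               tail_bound Ksw theta Q t]].

Definition averaged_set (Z : probability (vec R Dx) R) (eta : R) :
    set (probability (vec R Dxi) R) :=
  [set Q | [/\ ('E_Z[excess_loss Q] <= eta%:E)%E,
               (second_moment Q <= Om%:E)%E &
               tail_bound Ksw theta Q t]].

End ambiguity_sets.

Definition log_threshold (R : realType) (Ksw theta : R) (M : nat) : R :=
  Ksw * ln M%:R `^ (1 / theta).

Definition eta_bound (R : realType) (C : R) (J Dx Dxi : nat)
    (L : pwa R J Dx Dxi) (Rx Ksw theta c1 c2 Om : R) (M : nat) (tau : R) : R :=
  C * loss_radius L Rx (log_threshold Ksw theta M) *
    Num.sqrt (J%:R * ln J%:R * ln M%:R ^+ 3 / M%:R)
  + 2 * (c1 + c2 * Num.sqrt Om) * Num.sqrt (1 / (2 * M%:R) * ln (1 / tau))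
  + 4 * c1 / M%:R
  + 2 * c2 * Num.sqrt (2 * Om / M%:R).

(* P-probability at least p, without presupposing that the event is
   measurable; for measurable events this is p <= P event. *)
Definition holds_with_prob (R : realType) (d : measure_display)
    (T : measurableType d) (P : probability T R) (event : set T) (p : R) : Prop :=
  exists E : set T, [/\ measurable E, E `<=` event & (p%:E <= P E)%E].

(* Main.v *)
Require Import Defs.
From HB Require Import structures.
From mathcomp Require Import all_boot all_order all_algebra.
From mathcomp Require Import all_classical all_reals all_analysis.
From mathcomp Require Import measurable_realfun.
From mathcomp Require Import ring lra.

Set Implicit Arguments.
Unset Strict Implicit.
Unset Printing Implicit Defensive.

Import Order.TTheory GRing.Theory Num.Theory.
Import numFieldNormedType.Exports.

Local Open Scope classical_set_scope.
Local Open Scope ring_scope.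

(** The sampled constraints force, for every [Q] of the set, the excess losses at the
    sample points to be zero.  The claim is therefore a one-sided uniform law of
    large numbers for the functions [x -> excess_loss Q x], indexed by the
    distributions [Q] with second moment at most [Om] and light tail at [t].

    These functions take values in [[0, B]] with [B = 2 * (c1 + c2 * sqrt Om)], so
    by McDiarmid's inequality ([bounded_difference_tail]) the largest deviation
    exceeds its mean by [B * sqrt (ln (1 / tau) / (2 * M))] with probability at
    most [tau].  This is the second term of the bound.

    The mean deviation is bounded by a chain of replacements inside the mean of a
    supremum, each made for one sample point under an arbitrary bounded
    perturbation of the family ([dominated]) and then iterated over the sample
    ([iid_dominated]).  Symmetrization introduces an independent copy and a random
    sign.  Contraction ([contraction_dominated]) removes the positive part and the
    reference distribution, leaving the mean loss under [Q].  That mean is, up to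
    the mass outside the ball of radius [t] ([mean_truncated_le], the source of
    the last two terms), an average of values at single points of the ball, so the
    supremum over [Q] becomes a supremum over vectors.  There the loss is a
    maximum of [J] linear forms.  Since the largest of [J] numbers is at most the
    mean absolute value of their randomly signed sum, contraction again replaces
    the maximum by the forms themselves with [J] independent signs
    ([lmax_dominated]).  The supremum of the resulting linear form is the length
    of a random walk of [M * J] uncorrelated steps, of order [sqrt (M * J)]
    ([linear_complexity_le]).  Divided by [M] this gives twice the loss radius times
    [sqrt (J / M)], which the logarithmic factors can only enlarge.

    Measurability of suprema over infinitely many distributions never arises,
    because all of this takes place over a finite sample space.  The compact set
    [X] is cut into finitely many measurable cells on which all excess losses vary
    little ([compact_discretization]), uniformly in [Q] because they share a
    Lipschitz constant.  The error is paid for by a third multiple of the loss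
    radius times [sqrt (J / M)], which is positive unless the loss vanishes. *)

(** * Hoeffding's lemma for two points *)

Lemma eqW d (T : porderType d) (x y : T) : x = y -> (x <= y)%O.
Proof. by move=> ->. Qed.

Section Hoeffding.
Context {R : realType}.
Implicit Types p h x : R.

Lemma mgf_den_gt0 p h : 0 <= p <= 1 -> 0 < 1 - p + p * expR h.
Proof.
move=> /andP[p0 p1]; have e0 := expR_gt0 h.
have [->|pn0] := eqVneq p 0; first by rewrite mul0r addr0 subr0 ltr01.
by apply: ltr_wpDl; [rewrite subr_ge0|rewrite mulr_gt0// lt_def pn0].
Qed.

Lemma is_derive_mgf p x :
  is_derive x (1 : R) (fun y => 1 - p + p * expR y) (p * expR x).
Proof.
apply: is_derive_eq; rewrite /= ?scaler0 ?add0r ?subr0 /GRing.scale /=.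
by ring.
Qed.

(** For the two-point distribution with mass [p] at [1], the quotient of the left
    side by [1 - p + p * expR h] is the mass [g] of [1] after exponential tilting.
    It starts at [p] and grows at the rate [g * (1 - g)], which never exceeds
    [1 / 4]. *)
Lemma bernoulli_tilt_le p h : 0 <= p <= 1 -> 0 <= h ->
  p * expR h <= (p + h / 4) * (1 - p + p * expR h).
Proof.
move=> p01 h0; have den0 x := @mgf_den_gt0 p x p01.
pose G x := p + x / 4 - p * expR x * (1 - p + p * expR x)^-1.
have dG x : is_derive x (1 : R) G
    (4^-1 - p * (1 - p) * expR x * (1 - p + p * expR x) ^- 2).
  have -> : G = (fun x => p + 4^-1 * x - 1 + (1 - p) * (1 - p + p * expR x)^-1).
    apply/funext => y; rewrite /G.
    have yn := lt0r_neq0 (den0 y); field.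
    by rewrite yn.
  have dD := is_derive_mgf p x.
  have dV : is_derive x (1 : R) (fun y : R => (1 - p + p * expR y)^-1)
      (- (1 - p + p * expR x) ^- 2 * (p * expR x)).
    apply: DeriveDef; first by apply: derivableV; rewrite ?lt0r_neq0.
    by rewrite deriveV ?lt0r_neq0// derive_val.
  apply: is_derive_eq; rewrite /GRing.scale /=; ring.
have G0 : G 0 = 0 by rewrite /G expR0 !mulr1 subrK invr1 mulr1 mul0r addr0 subrr.
suff : 0 <= G h by rewrite /G subr_ge0 ler_pdivrMr.
rewrite -G0; apply: (@ger0_derive1_ndecr _ G 0 h) => //.
- move=> x _; rewrite derive1E derive_val subr_ge0 ler_pdivrMr ?exprn_gt0//.
  rewrite -subr_ge0.
  set u := expR x; have -> : 4^-1 * (1 - p + p * u) ^+ 2 - p * (1 - p) * u =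
    4^-1 * (1 - p - p * u) ^+ 2 by field.
  by rewrite mulr_ge0 ?sqr_ge0.
- apply: derivable_within_continuous => x _; exact: ex_derive.
Qed.

(** Hoeffding's lemma for two points: the derivative of the logarithm of the left
    side is the tilted mass, controlled by the preceding lemma. *)
Lemma bernoulli_mgf_le p h : 0 <= p <= 1 -> 0 <= h ->
  1 - p + p * expR h <= expR (p * h + h ^+ 2 / 8).
Proof.
move=> p01 h0; have den0 x := @mgf_den_gt0 p x p01.
pose G x := p * x + x ^+ 2 / 8 - ln (1 - p + p * expR x).
have dG x : is_derive x (1 : R) G
    (p + x / 4 - p * expR x / (1 - p + p * expR x)).
  have dD := is_derive_mgf p x.
  have dl := is_derive1_ln (den0 x).
  have dc : is_derive x (1 : R) (fun y => ln (1 - p + p * expR y))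
      ((1 - p + p * expR x)^-1 * (p * expR x)) by exact: is_derive1_comp.
  have -> : G = (fun x => p * x + 8^-1 * x ^+ 2 - ln (1 - p + p * expR x)).
    by apply/funext => y; rewrite /G (mulrC 8^-1).
  apply: is_derive_eq; rewrite /GRing.scale /=.
  have yn := lt0r_neq0 (den0 x); field.
  by rewrite yn.
have G0 : G 0 = 0 by rewrite /G expR0 mulr1 subrK ln1 mulr0 expr0n/= mul0r addr0 subr0.
suff : 0 <= G h.
  by rewrite subr_ge0 -ler_expR lnK// posrE.
rewrite -G0; apply: (@ger0_derive1_ndecr _ G 0 h) => //.
- move=> x; rewrite in_itv/= => /andP[x0 _].
  rewrite derive1E derive_val subr_ge0 ler_pdivrMr//.
  by apply: bernoulli_tilt_le => //; exact: ltW.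
- apply: derivable_within_continuous => x _; exact: ex_derive.
Qed.

End Hoeffding.

(** * Finite probability and independent samples *)

Section FiniteMean.
Context {R : realType}.

Definition prob_weight (A : finType) (w : A -> R) : Prop :=
  (forall a, 0 <= w a) /\ \sum_a w a = 1.

Definition fmean (A : finType) (w : A -> R) (F : A -> R) : R :=
  \sum_a w a * F a.

(** The mean over [M] independent draws, one draw at a time: every statement about
    samples below is an induction that peels off a draw. *)
Fixpoint iidmean (A : finType) (w : A -> R) (M : nat) (F : seq A -> R) : R :=
  if M is M'.+1 then fmean w (fun a => iidmean w M' (fun s => F (a :: s)))
  else F [::].

Section OneWeight.
Context (A : finType) (w : A -> R).
Hypothesis pw : prob_weight w.

Lemma eq_fmean (F G : A -> R) : F =1 G -> fmean w F = fmean w G.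
Proof. by move=> FG; apply: eq_bigr => a _; rewrite FG. Qed.

Lemma le_fmean (F G : A -> R) : (forall a, F a <= G a) ->
  fmean w F <= fmean w G.
Proof. by case: pw => w0 _ FG; apply: ler_sum => a _; rewrite ler_wpM2l. Qed.

Lemma fmean_cst c : fmean w (fun=> c) = c.
Proof. by case: pw => _ w1; rewrite /fmean -mulr_suml w1 mul1r. Qed.

Lemma fmeanD F G : fmean w (fun a => F a + G a) = fmean w F + fmean w G.
Proof. by rewrite -big_split; apply: eq_bigr => a _; rewrite mulrDr. Qed.

Lemma fmeanZ c F : fmean w (fun a => c * F a) = c * fmean w F.
Proof. by rewrite mulr_sumr; apply: eq_bigr => a _; rewrite mulrCA. Qed.

Lemma fmeanZr c F : fmean w (fun a => F a * c) = fmean w F * c.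
Proof. by rewrite mulr_suml; apply: eq_bigr => a _; rewrite mulrA. Qed.

Lemma fmeanN F : fmean w (fun a => - F a) = - fmean w F.
Proof. by rewrite -sumrN; apply: eq_bigr => a _; rewrite mulrN. Qed.

Lemma fmean_sum (B : finType) (F : B -> A -> R) :
  fmean w (fun a => \sum_b F b a) = \sum_b fmean w (F b).
Proof.
by rewrite exchange_big; apply: eq_bigr => a _; rewrite mulr_sumr.
Qed.

Lemma norm_fmean_le F : `|fmean w F| <= fmean w (fun a => `|F a|).
Proof.
case: pw => w0 _; apply: le_trans (ler_norm_sum _ _ _) _.
by apply: ler_sum => a _; rewrite normrM ger0_norm.
Qed.

Lemma fmean_bound B F : (forall a, `|F a| <= B) -> `|fmean w F| <= B.
Proof.
by move=> FB; apply: le_trans (norm_fmean_le _) _; rewrite -[leRHS]fmean_cst le_fmean.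
Qed.

Lemma prob_weight_inhabited : exists a : A, true.
Proof.
case: pw => _ w1; case: (pickP (xpredT : pred A)) => [a _|A0]; first by exists a.
by move: w1; rewrite big_pred0// => /eqP; rewrite eq_sym oner_eq0.
Qed.

Lemma le_iidmean M F G : (forall s, size s = M -> F s <= G s) ->
  iidmean w M F <= iidmean w M G.
Proof.
elim: M F G => [|M IH] F G FG /=; first exact: FG.
by apply: le_fmean => a; apply: IH => s sM; apply: FG; rewrite /= sM.
Qed.

Lemma iidmean_cst M c : iidmean w M (fun=> c) = c.
Proof. by elim: M => //= M IH; rewrite IH fmean_cst. Qed.

Lemma iidmeanD M F G :
  iidmean w M (fun s => F s + G s) = iidmean w M F + iidmean w M G.
Proof.
by elim: M F G => //= M IH F G; rewrite -fmeanD; apply: eq_fmean => a; exact: IH.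
Qed.

Lemma iidmeanZ M c F : iidmean w M (fun s => c * F s) = c * iidmean w M F.
Proof.
by elim: M F => //= M IH F; rewrite -fmeanZ; apply: eq_fmean => a; exact: IH.
Qed.

Lemma fmean_iidmeanC (B : finType) (u : B -> R) M (F : B -> seq A -> R) :
  fmean u (fun b => iidmean w M (F b)) = iidmean w M (fun s => fmean u (F^~ s)).
Proof.
elim: M F => //= M IH F; under [RHS]eq_fmean do rewrite -IH.
rewrite /fmean; under eq_bigr do rewrite mulr_sumr.
rewrite exchange_big; apply: eq_bigr => a _; rewrite mulr_sumr.
by apply: eq_bigr => b _; rewrite mulrCA.
Qed.

(** The product form, in which independence of random variables is stated. *)
Lemma iidmeanE M F :
  iidmean w M F = \sum_(t : M.-tuple A) (\prod_(a <- t) w a) * F t.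
Proof.
elim: M F => [|M IH] F /=.
  rewrite (big_pred1 [tuple]) ?big_nil ?mul1r// => t.
  by rewrite (tuple0 t); apply/esym/eqP/val_inj.
transitivity (fmean w (fun a =>
    \sum_(t : M.-tuple A) (\prod_(b <- t) w b) * F (a :: t))).
  by apply: eq_fmean => a; exact: IH.
rewrite /fmean /=; under eq_bigr do rewrite mulr_sumr.
rewrite pair_big/= (reindex (fun p : A * M.-tuple A => [tuple of p.1 :: p.2])).
  by apply: eq_bigr => -[a t] _ /=; rewrite big_cons mulrA.
exists (fun t : M.+1.-tuple A => (thead t, [tuple of behead t])).
  by move=> [a t] _; congr pair; apply: val_inj.
by move=> t _; rewrite -tuple_eta.
Qed.

(** Hoeffding's lemma.  By convexity the exponential lies below its chord on the
    range of [F]; averaging the chord leaves the two-point case. *)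
Lemma fmean_exp_le (F : A -> R) (c lambda : R) :
  0 < c -> 0 <= lambda -> (forall a b, F a - F b <= c) ->
  fmean w (fun a => expR (lambda * F a)) <=
  expR (lambda * fmean w F + lambda ^+ 2 * c ^+ 2 / 8).
Proof.
move=> c0 l0 Fc; have [w0 w1] := pw.
have [i0 _] := prob_weight_inhabited.
have [a0 _ Fmin'] := @arg_minP _ R A i0 predT F isT.
have Fmin a : F a0 <= F a by exact: Fmin'.
pose q a := (F a - F a0) / c.
have q01 a : 0 <= q a <= 1.
  apply/andP; split; first by apply: divr_ge0; rewrite ?subr_ge0 ?Fmin ?ltW.
  by rewrite ler_pdivrMr ?mul1r.
have chord a : expR (lambda * F a) <=
    expR (lambda * F a0) * (1 - q a + q a * expR (lambda * c)).
  have /andP[qa0 qa1] := q01 a.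
  have := @convex_expR R (Itv01 qa0 qa1) (lambda * c) 0.
  rewrite !convRE /= /unstable.onem expR0 mulr0 addr0 mulr1 => qconv.
  have -> : lambda * F a = lambda * F a0 + q a * (lambda * c).
    by rewrite /q; field; rewrite gt_eqF.
  by rewrite expRD ler_wpM2l ?expR_ge0// addrC.
pose p := fmean w q.
have p01 : 0 <= p <= 1.
  apply/andP; split.
    by rewrite -[leLHS](fmean_cst 0) le_fmean// => a; case/andP: (q01 a).
  by rewrite -[leRHS](fmean_cst 1) le_fmean// => a; case/andP: (q01 a).
apply: le_trans (le_fmean chord) _.
rewrite fmeanZ fmeanD fmeanZr fmeanD fmeanN fmean_cst -/p.
apply: (@le_trans _ _ (expR (lambda * F a0) *
    expR (p * (lambda * c) + (lambda * c) ^+ 2 / 8))).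
  rewrite ler_wpM2l ?expR_ge0//; apply: bernoulli_mgf_le => //.
  by rewrite mulr_ge0// ltW.
rewrite -expRD ler_expR /p /q fmeanZr fmeanD fmean_cst.
have cn : c != 0 by rewrite gt_eqF.
by apply: eqW; field.
Qed.

End OneWeight.
End FiniteMean.

(** * Bounded differences, symmetrization and contraction *)

Section McDiarmid.
Context {R : realType} (A : finType) (w : A -> R).
Hypothesis pw : prob_weight w.

(** Conditioning on the first draw: the conditional means of [F] vary by at most
    [c], so Hoeffding's lemma costs one factor per draw. *)
Lemma bounded_difference_mgf M (F : seq A -> R) (c lambda : R) :
  0 < c -> 0 <= lambda ->
  (forall s1 a b s2, F (s1 ++ a :: s2) - F (s1 ++ b :: s2) <= c) ->
  iidmean w M (fun s => expR (lambda * F s)) <=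
  expR (lambda * iidmean w M F + M%:R * (lambda ^+ 2 * c ^+ 2 / 8)).
Proof.
move=> c0 l0; elim: M F => [|M IH] F Fc /=; first by rewrite mul0r addr0.
set k := lambda ^+ 2 * c ^+ 2 / 8 in IH *.
pose G a := iidmean w M (fun s => F (a :: s)).
apply: (@le_trans _ _ (fmean w (fun a => expR (lambda * G a) * expR (M%:R * k)))).
  apply: le_fmean => // a; rewrite -expRD; apply: IH => s1 b b' s2.
  exact: (Fc (a :: s1)).
have -> : lambda * fmean w G + M.+1%:R * k = (lambda * fmean w G + k) + M%:R * k.
  by rewrite mulrSr mulrDl mul1r -addrA [k + _]addrC.
rewrite fmeanZr expRD ler_wpM2r ?expR_ge0//; rewrite /k.
apply: (@fmean_exp_le R A w pw G c lambda c0 l0) => a b.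
rewrite /G lerBlDr -(iidmean_cst pw M c) -iidmeanD//.
by apply: le_iidmean => // s _; rewrite -lerBlDr; exact: (Fc [::]).
Qed.

(** McDiarmid's inequality, by the Chernoff bound.  The indicator is averaged
    instead of a probability, since a finite sample space needs no measure. *)
Lemma bounded_difference_tail M (F : seq A -> R) (c d : R) :
  (0 < M)%N -> 0 < c -> 0 <= d ->
  (forall s1 a b s2, F (s1 ++ a :: s2) - F (s1 ++ b :: s2) <= c) ->
  iidmean w M (fun s => (iidmean w M F + d < F s)%R%:R) <=
  expR (- (2 * d ^+ 2 / (M%:R * c ^+ 2))).
Proof.
move=> M0 c0 d0 Fc; set m := iidmean w M F.
have MR : 0 < M%:R :> R by rewrite ltr0n.
(* the exponent minimising the Chernoff bound *)
pose l := 4 * d / (M%:R * c ^+ 2).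
have l0 : 0 <= l by rewrite divr_ge0 ?mulr_ge0 ?sqr_ge0// ltW.
apply: (@le_trans _ _ (iidmean w M
    (fun s => expR (- (l * (m + d))) * expR (l * F s)))).
  apply: le_iidmean => // s _; rewrite -expRD [X in expR X]addrC -mulrBr.
  case: ltP => [lt|_]; last exact: expR_ge0.
  by rewrite -expR0 ler_expR mulr_ge0// subr_ge0 ltW.
rewrite iidmeanZ//.
apply: (@le_trans _ _ (expR (- (l * (m + d))) *
    expR (l * m + M%:R * (l ^+ 2 * c ^+ 2 / 8)))).
  by rewrite ler_wpM2l ?expR_ge0//; exact: bounded_difference_mgf.
rewrite -expRD ler_expR /l.
have cn : c != 0 by rewrite gt_eqF.
have Mn : M%:R != 0 :> R by rewrite gt_eqF.
apply: eqW; field.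
by rewrite cn Mn.
Qed.

End McDiarmid.

Section BoundedFamilies.
Context {R : realType} {I : Type}.
Implicit Types f g : I -> R.

Definition bounded_family f : Prop := exists B, forall i, `|f i| <= B.

Definition rsup f : R := sup (range f).

Lemma le_rsup f i : bounded_family f -> f i <= rsup f.
Proof.
move=> [B fB]; apply: ub_le_sup; last by exists i.
by exists B => _ [j _ <-]; apply: le_trans (fB j); exact: ler_norm.
Qed.

Lemma rsup_le (i0 : I) f c : (forall i, f i <= c) -> rsup f <= c.
Proof. by move=> fc; apply: ge_sup; [exists (f i0), i0|move=> _ [i _ <-]]. Qed.

Lemma bounded_familyD f g : bounded_family f -> bounded_family g ->
  bounded_family (fun i => f i + g i).
Proof.
move=> [B fB] [C gC]; exists (B + C) => i.
by apply: le_trans (ler_normD _ _) _; rewrite lerD.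
Qed.

Lemma bounded_familyZ c f : bounded_family f -> bounded_family (fun i => c * f i).
Proof. by move=> [B fB]; exists (`|c| * B) => i; rewrite normrM ler_wpM2l. Qed.

Lemma bounded_family_sum (T : Type) (s : seq T) (phi : T -> I -> R) :
  (forall a, bounded_family (phi a)) ->
  bounded_family (fun i => \sum_(a <- s) phi a i).
Proof.
move=> bphi; elim: s => [|a s IH].
  by exists 0 => i; rewrite big_nil normr0.
under eq_fun do rewrite big_cons.
exact: bounded_familyD.
Qed.

Lemma le_rsup_family (i0 : I) f g : bounded_family g -> (forall i, f i <= g i) ->
  rsup f <= rsup g.
Proof. by move=> bg fg; apply: (rsup_le i0) => i; apply: le_trans (le_rsup i bg). Qed.

End BoundedFamilies.

Section Domination.
Context {R : realType} {I : Type} (i0 : I).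

(** The random functional [phi a], with [a] drawn from [u], is replaced by
    [psi b], with [b] drawn from [w], under any bounded perturbation [h] of the
    family.  The perturbation stands for all the other summands of a sum, so that
    summands can be replaced one at a time. *)
Definition dominated (A B : finType) (u : A -> R) (w : B -> R)
    (phi : A -> I -> R) (psi : B -> I -> R) : Prop :=
  forall h, bounded_family h ->
  fmean u (fun a => rsup (fun i => h i + phi a i)) <=
  fmean w (fun b => rsup (fun i => h i + psi b i)).

Lemma dominated_trans (A B D : finType) (u : A -> R) (v : B -> R) (w : D -> R)
    (phi : A -> I -> R) (psi : B -> I -> R) (chi : D -> I -> R) :
  dominated u v phi psi -> dominated v w psi chi -> dominated u w phi chi.
Proof. by move=> uv vw h bh; apply: le_trans (uv h bh) (vw h bh). Qed.

(** Replacing the summands one at a time: the partial sum already drawn, and the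
    one still to come, are absorbed into the perturbation. *)
Lemma iid_dominated (A B : finType) (u : A -> R) (w : B -> R)
    (phi : A -> I -> R) (psi : B -> I -> R) :
  prob_weight u -> prob_weight w -> (forall a, bounded_family (phi a)) ->
  (forall b, bounded_family (psi b)) -> dominated u w phi psi ->
  forall M h, bounded_family h ->
  iidmean u M (fun s => rsup (fun i => h i + \sum_(a <- s) phi a i)) <=
  iidmean w M (fun s => rsup (fun i => h i + \sum_(b <- s) psi b i)).
Proof.
move=> pu pw bphi bpsi uw; elim=> [|M IH] h bh /=.
  apply: (le_rsup_family i0) => [|i]; last by rewrite !big_nil.
  exact: bounded_familyD bh (bounded_family_sum [::] bpsi).
pose G (a : A) := iidmean w M
  (fun s => rsup (fun i => (h i + phi a i) + \sum_(b <- s) psi b i)).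
apply: (@le_trans _ _ (fmean u G)).
  apply: le_fmean => // a; apply: le_trans (IH _ (bounded_familyD bh (bphi a))).
  apply: le_iidmean => // s _; apply: eqW.
  by congr rsup; apply/funext => i; rewrite big_cons addrA.
rewrite /G fmean_iidmeanC -[leRHS]/(fmean w (fun b => iidmean w M
  (fun s => rsup (fun i => h i + \sum_(b <- b :: s) psi b i)))) fmean_iidmeanC.
apply: le_iidmean => // s _.
have := uw (fun i => h i + \sum_(b <- s) psi b i)
  (bounded_familyD bh (bounded_family_sum s bpsi)).
under eq_fmean do under eq_fun do rewrite addrAC.
move=> /le_trans; apply; apply: eqW.
apply: eq_fmean => b; congr rsup; apply/funext => i.
by rewrite big_cons -addrA [psi b i + _]addrC.
Qed.

Corollary iid_dominated0 (A B : finType) (u : A -> R) (w : B -> R)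
    (phi : A -> I -> R) (psi : B -> I -> R) M :
  prob_weight u -> prob_weight w -> (forall a, bounded_family (phi a)) ->
  (forall b, bounded_family (psi b)) -> dominated u w phi psi ->
  iidmean u M (fun s => rsup (fun i => \sum_(a <- s) phi a i)) <=
  iidmean w M (fun s => rsup (fun i => \sum_(b <- s) psi b i)).
Proof.
move=> pu pw bphi bpsi uw.
have b0 : bounded_family (fun _ : I => 0 : R) by exists 0 => i; rewrite normr0.
have add0 (T : Type) (chi : T -> I -> R) :
    (fun s => rsup (fun i => 0 + \sum_(a <- s) chi a i)) =
    (fun s => rsup (fun i => \sum_(a <- s) chi a i)).
  by apply/funext => s; congr rsup; apply/funext => i; rewrite add0r.
by have := iid_dominated pu pw bphi bpsi uw M b0; rewrite !add0.
Qed.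

Definition sign (b : bool) : R := if b then 1 else -1.

Definition coin : bool -> R := fun=> 2^-1.

Definition pair_weight (A B : finType) (u : A -> R) (w : B -> R) (p : A * B) : R :=
  u p.1 * w p.2.

Lemma fmean_pair (A B : finType) (u : A -> R) (w : B -> R) F :
  fmean (pair_weight u w) F = fmean u (fun a => fmean w (fun b => F (a, b))).
Proof.
rewrite /fmean; under [RHS]eq_bigr do rewrite mulr_sumr.
by rewrite pair_big; apply: eq_bigr => -[a b] _ /=; rewrite mulrA.
Qed.

Lemma pair_prob_weight (A B : finType) (u : A -> R) (w : B -> R) :
  prob_weight u -> prob_weight w -> prob_weight (pair_weight u w).
Proof.
move=> pu pw; split=> [p|].
  by rewrite mulr_ge0//; [case: pu|case: pw].
transitivity (fmean (pair_weight u w) (fun=> 1)).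
  by apply: eq_bigr => p _; rewrite mulr1.
by rewrite fmean_pair (fmean_cst pw) (fmean_cst pu).
Qed.

Lemma coin_prob_weight : prob_weight coin.
Proof. by split=> [b|]; rewrite /coin ?invr_ge0// big_bool/=; field. Qed.

Lemma fmean_coin (F : bool -> R) : fmean coin F = 2^-1 * (F true + F false).
Proof. by rewrite /fmean big_bool mulrDr. Qed.

(** Contraction and symmetrization act on the random signs alone, at each fixed
    sample point. *)
Lemma dominated_pair (A B D : finType) (u : A -> R) (v : B -> R) (w : D -> R)
    (phi : A * B -> I -> R) (psi : A * D -> I -> R) :
  prob_weight u ->
  (forall a, dominated v w (fun b => phi (a, b)) (fun d => psi (a, d))) ->
  dominated (pair_weight u v) (pair_weight u w) phi psi.
Proof. by move=> pu H h bh; rewrite !fmean_pair le_fmean// => a; exact: H. Qed.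

(** Symmetrization.  The mean is an independent copy [f b]; by convexity of the
    supremum the difference [f b - f a] is the midpoint of [2 * f b] and
    [- 2 * f a]. *)
Lemma symmetrization_dominated (A : finType) (u : A -> R) (f : A -> I -> R) :
  prob_weight u -> (forall a, bounded_family (f a)) ->
  dominated u (pair_weight u coin) (fun a i => fmean u (f^~ i) - f a i)
    (fun p i => sign p.2 * (2 * f p.1 i)).
Proof.
move=> pu bf h bh; rewrite fmean_pair.
pose S e a := rsup (fun i => h i + sign e * (2 * f a i)).
have bS e a : bounded_family (fun i => h i + sign e * (2 * f a i)).
  by apply: bounded_familyD => //; do 2 apply: bounded_familyZ.
under [leRHS]eq_fmean do rewrite fmean_coin -/(S true _) -/(S false _).
apply: (@le_trans _ _
    (fmean u (fun a => fmean u (fun b => 2^-1 * (S true b + S false a))))).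
  apply: le_fmean => // a; apply: (rsup_le i0) => i.
  have -> : h i + (fmean u (f^~ i) - f a i) =
      fmean u (fun b => (h i - f a i) + f b i).
    by rewrite fmeanD (fmean_cst pu) addrCA addrC.
  apply: le_fmean => // b.
  have := le_rsup i (bS true b); have := le_rsup i (bS false a).
  by rewrite /S /= /sign; lra.
under eq_fmean do rewrite fmeanZ fmeanD (fmean_cst pu).
by rewrite !fmeanZ !fmeanD (fmean_cst pu).
Qed.

(** Contraction.  If the increments of [g] are at most the mean absolute
    increments of a symmetric random functional [X], then a random sign times [g]
    may be replaced by [X]: the two signs give the increments of [g], and symmetry
    turns the absolute increments of [X] into signed ones. *)
Lemma contraction_dominated (B : finType) (w : B -> R) (opp : B -> B)
    (g : I -> R) (X : B -> I -> R) :
  prob_weight w -> bounded_family g -> (forall b, bounded_family (X b)) ->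
  bijective opp -> (forall b, w (opp b) = w b) ->
  (forall b i, X (opp b) i = - X b i) ->
  (forall i j, g i - g j <= fmean w (fun b => `|X b i - X b j|)) ->
  dominated coin w (fun e i => sign e * g i) X.
Proof.
move=> pw bg bX bij wopp Xopp gX h bh; rewrite fmean_coin.
pose T b := rsup (fun i => h i + X b i).
have bT b : bounded_family (fun i => h i + X b i) by exact: bounded_familyD.
have symT : fmean w (fun b => T (opp b)) = fmean w T.
  rewrite [RHS]/fmean (reindex opp) /=; last exact: onW_bij.
  by apply: eq_bigr => b _; rewrite wopp.
have key i j : (h i + g i) + (h j - g j) <= 2 * fmean w T.
  have -> : 2 * fmean w T = fmean w (fun b => T b + T (opp b)).
    by rewrite fmeanD symT; ring.
  apply: (@le_trans _ _ (fmean w (fun b => (h i + h j) + `|X b i - X b j|))).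
    by rewrite fmeanD (fmean_cst pw); have := gX i j; lra.
  apply: le_fmean => // b.
  have Ti := le_rsup i (bT b); have Tj := le_rsup j (bT b).
  have T'i := le_rsup i (bT (opp b)); have T'j := le_rsup j (bT (opp b)).
  rewrite !Xopp in T'i T'j; rewrite /T.
  by case: (ger0P (X b i - X b j)) => _; lra.
suff : rsup (fun i => h i + sign true * g i) <=
    2 * fmean w T - rsup (fun i => h i + sign false * g i).
  by rewrite -/T; lra.
apply: (rsup_le i0) => i; rewrite lerBrDr addrC -lerBrDr.
apply: (rsup_le i0) => j; have := key i j.
by rewrite /sign; lra.
Qed.

End Domination.

(** * Euclidean and operator norms *)

Section Euclidean.
Context {R : realType}.

Definition dotv (n : nat) (u v : 'cV[R]_n) : R := \sum_i u i ord0 * v i ord0.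

Lemma dotvE n (u v : 'cV[R]_n) : dotv u v = (u^T *m v) ord0 ord0.
Proof. by rewrite mxE; apply: eq_bigr => i _; rewrite mxE. Qed.

Lemma dotvC n (u v : 'cV[R]_n) : dotv u v = dotv v u.
Proof. by apply: eq_bigr => i _; rewrite mulrC. Qed.

Lemma dotvDl n (u u' v : 'cV[R]_n) : dotv (u + u') v = dotv u v + dotv u' v.
Proof. by rewrite -big_split; apply: eq_bigr => i _; rewrite mxE mulrDl. Qed.

Lemma dotvZl n a (u v : 'cV[R]_n) : dotv (a *: u) v = a * dotv u v.
Proof. by rewrite mulr_sumr; apply: eq_bigr => i _; rewrite mxE mulrA. Qed.

Lemma dotv0l n (v : 'cV[R]_n) : dotv 0 v = 0.
Proof. by apply: big1 => i _; rewrite mxE mul0r. Qed.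

Lemma dotvBr n (u v v' : 'cV[R]_n) : dotv u (v - v') = dotv u v - dotv u v'.
Proof. by rewrite dotvC dotvDl -scaleN1r dotvZl mulN1r !(dotvC _ u). Qed.

Lemma dotvBl n (u u' v : 'cV[R]_n) : dotv (u - u') v = dotv u v - dotv u' v.
Proof. by rewrite dotvC dotvBr !(dotvC v). Qed.

Lemma dotvZr n a (u v : 'cV[R]_n) : dotv u (a *: v) = a * dotv u v.
Proof. by rewrite dotvC dotvZl dotvC. Qed.

Lemma dotv_suml n (T : Type) (s : seq T) (u : T -> 'cV[R]_n) v :
  dotv (\sum_(a <- s) u a) v = \sum_(a <- s) dotv (u a) v.
Proof.
by elim: s => [|a s IH]; rewrite ?big_nil ?dotv0l// !big_cons dotvDl IH.
Qed.

Lemma dotv_ge0 n (u : 'cV[R]_n) : 0 <= dotv u u.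
Proof. by apply: sumr_ge0 => i _; rewrite -expr2 sqr_ge0. Qed.

Lemma enorm_ge0 n (u : 'cV[R]_n) : 0 <= enorm u.
Proof. exact: sqrtr_ge0. Qed.

Lemma enorm_sqr n (u : 'cV[R]_n) : enorm u ^+ 2 = dotv u u.
Proof.
rewrite /enorm sqr_sqrtr; last by apply: sumr_ge0 => i _; exact: sqr_ge0.
by apply: eq_bigr => i _; rewrite expr2.
Qed.

Lemma enormZ n a (u : 'cV[R]_n) : enorm (a *: u) = `|a| * enorm u.
Proof.
rewrite /enorm -sqrtr_sqr -sqrtrM ?sqr_ge0//; congr Num.sqrt.
by rewrite mulr_sumr; apply: eq_bigr => i _; rewrite mxE exprMn.
Qed.

Lemma enormN n (u : 'cV[R]_n) : enorm (- u) = enorm u.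
Proof. by rewrite -scaleN1r enormZ normrN1 mul1r. Qed.

Lemma enorm0 n : enorm (0 : 'cV[R]_n) = 0.
Proof. by rewrite -(scale0r 0) enormZ normr0 mul0r. Qed.

Lemma enorm_eq0 n (u : 'cV[R]_n) : enorm u = 0 -> u = 0.
Proof.
move=> u0; have : dotv u u = 0 by rewrite -enorm_sqr u0 expr0n.
move/eqP; rewrite psumr_eq0; last by move=> i _; rewrite -expr2 sqr_ge0.
move=> /allP uu; apply/matrixP => i j; rewrite mxE ord1; apply/eqP.
by have := uu i (mem_index_enum i); rewrite mulf_eq0 orbb.
Qed.

Lemma cauchy_schwarz n (u v : 'cV[R]_n) : `|dotv u v| <= enorm u * enorm v.
Proof.
have [v0|vn0] := eqVneq (enorm v) 0.
  by rewrite (enorm_eq0 v0) dotvC dotv0l normr0 enorm0 mulr0.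
have vp : 0 < enorm v by rewrite lt_def vn0 enorm_ge0.
rewrite -(@ler_pXn2r _ 2)// ?nnegrE ?mulr_ge0 ?enorm_ge0//.
rewrite -normrX ger0_norm ?sqr_ge0// exprMn.
(* the squared norm of the component of u orthogonal to v *)
have := dotv_ge0 (enorm v ^+ 2 *: u - dotv u v *: v).
rewrite dotvBr !dotvBl !dotvZl !dotvZr (dotvC v u) -!enorm_sqr.
set a := enorm v ^+ 2; set b := dotv u v; set c := enorm u ^+ 2.
have a0 : 0 < a by rewrite exprn_gt0.
move=> h; have : 0 <= a * (c * a - b ^+ 2) by apply: le_trans h _; lra.
by rewrite pmulr_rge0// subr_ge0.
Qed.

Lemma enormD n (u v : 'cV[R]_n) : enorm (u + v) <= enorm u + enorm v.
Proof.
rewrite -(@ler_pXn2r _ 2)// ?nnegrE ?addr_ge0 ?enorm_ge0//.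
rewrite enorm_sqr dotvDl !(dotvC _ (u + v)) !dotvDl -!enorm_sqr (dotvC v u).
have := cauchy_schwarz u v; have := ler_norm (dotv u v).
by rewrite sqrrD; lra.
Qed.

Lemma enorm_distl n (u v : 'cV[R]_n) : `|enorm u - enorm v| <= enorm (u - v).
Proof.
rewrite ler_norml; apply/andP; split.
  have := enormD u (v - u); rewrite addrC subrK -(enormN (v - u)) opprB; lra.
by have := enormD v (u - v); rewrite addrC subrK; lra.
Qed.

Lemma enorm_sum n (T : Type) (s : seq T) (u : T -> 'cV[R]_n) :
  enorm (\sum_(a <- s) u a) <= \sum_(a <- s) enorm (u a).
Proof.
elim: s => [|a s IH]; first by rewrite !big_nil enorm0.
by rewrite !big_cons; apply: le_trans (enormD _ _) _; rewrite lerD2l.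
Qed.

(** Homogeneous coordinates, in which the affine pieces of the loss become linear
    forms. *)
Definition homog n (u : 'cV[R]_n) : 'cV[R]_(n + 1) := col_mx u 1%:M.

Lemma enorm_homog n (u : 'cV[R]_n) :
  enorm (homog u) = Num.sqrt (enorm u ^+ 2 + 1).
Proof.
rewrite -[LHS]ger0_norm ?enorm_ge0// -sqrtr_sqr; congr Num.sqrt.
rewrite !enorm_sqr /dotv big_split_ord/= big_ord1 col_mxEd !mxE eqxx mulr1.
by congr (_ + _); apply: eq_bigr => i _; rewrite col_mxEu.
Qed.

Lemma opnorm_has_ubound m n (B : 'M[R]_(m, n)) :
  has_ubound [set enorm (B *m v) | v in [set v : 'cV[R]_n | enorm v <= 1]].
Proof.
exists (\sum_j enorm (col j B)) => _ [w /= w1 <-].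
have -> : B *m w = \sum_j w j ord0 *: col j B.
  apply/matrixP => i k; rewrite mxE ord1 summxE.
  by apply: eq_bigr => j _; rewrite !mxE mulrC.
apply: le_trans (enorm_sum _ _) _; apply: ler_sum => j _.
rewrite enormZ ler_piMl ?enorm_ge0//.
apply: le_trans w1; rewrite -sqrtr_sqr ler_sqrt; last first.
  by apply: sumr_ge0 => k _; exact: sqr_ge0.
by rewrite (bigD1 j)//= lerDl sumr_ge0// => k _; exact: sqr_ge0.
Qed.

Lemma opnorm_ge0 m n (B : 'M[R]_(m, n)) : 0 <= opnorm B.
Proof.
apply: ub_le_sup; first exact: opnorm_has_ubound.
by exists 0; rewrite /= ?mulmx0 enorm0.
Qed.

Lemma le_opnorm m n (B : 'M[R]_(m, n)) (v : 'cV[R]_n) :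
  enorm (B *m v) <= opnorm B * enorm v.
Proof.
have [v0|vn0] := eqVneq (enorm v) 0.
  by rewrite (enorm_eq0 v0) mulmx0 !enorm0 mulr0.
have vp : 0 < enorm v by rewrite lt_def vn0 enorm_ge0.
rewrite -ler_pdivrMr//.
have -> : enorm (B *m v) / enorm v = enorm (B *m ((enorm v)^-1 *: v)).
  by rewrite -scalemxAr enormZ ger0_norm ?invr_ge0 ?enorm_ge0// mulrC.
apply: ub_le_sup; first exact: opnorm_has_ubound.
exists ((enorm v)^-1 *: v) => //=.
by rewrite enormZ ger0_norm ?invr_ge0 ?enorm_ge0// mulVf.
Qed.

(** Testing against [B^T *m w] itself moves the transpose to the other side. *)
Lemma le_opnorm_tr m n (B : 'M[R]_(m, n)) (w : 'cV[R]_m) :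
  enorm (B^T *m w) <= opnorm B * enorm w.
Proof.
have [z0|zn0] := eqVneq (enorm (B^T *m w)) 0.
  by rewrite z0 mulr_ge0 ?opnorm_ge0 ?enorm_ge0.
have zp : 0 < enorm (B^T *m w) by rewrite lt_def zn0 enorm_ge0.
rewrite -(ler_pM2l zp) -expr2 enorm_sqr.
have -> : dotv (B^T *m w) (B^T *m w) = dotv w (B *m (B^T *m w)).
  by rewrite !dotvE trmx_mul trmxK -mulmxA.
apply: le_trans (ler_norm _) _; apply: le_trans (cauchy_schwarz _ _) _.
rewrite mulrC mulrCA mulrA ler_wpM2r ?enorm_ge0//.
exact: le_opnorm.
Qed.

End Euclidean.

(** * Independent signs *)

Section SignVectors.
Context {R : realType} (J : nat).

Notation cube := {ffun 'I_J -> bool}.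

Definition cube_weight : cube -> R := fun=> #|{: cube}|%:R^-1.

Lemma cube_prob_weight : prob_weight cube_weight.
Proof.
split=> [b|]; first by rewrite invr_ge0 ler0n.
rewrite sumr_const -[_ *+ _]mulr_natr mulVf// pnatr_eq0 -lt0n.
by apply/card_gt0P; exists [ffun=> true].
Qed.

Definition flip (P : pred 'I_J) (b : cube) : cube :=
  [ffun k => if P k then ~~ b k else b k].

Lemma flipK P : involutive (flip P).
Proof. by move=> b; apply/ffunP => k; rewrite !ffunE; case: (P k); rewrite ?negbK. Qed.

Lemma sign_neg b : sign (~~ b) = - sign b :> R.
Proof. by case: b; rewrite /sign ?opprK. Qed.

(** Orthogonality of the signs comes from flipping some of them, which preserves
    the uniform weight. *)
Lemma fmean_odd P (F : cube -> R) : (forall b, F (flip P b) = - F b) ->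
  fmean cube_weight F = 0.
Proof.
move=> oddF; suff : fmean cube_weight F = - fmean cube_weight F by lra.
rewrite -fmeanN [LHS]/fmean (reindex (flip P)) /=; last first.
  exact: onW_bij (inv_bij (flipK P)).
by apply: eq_bigr => b _; rewrite oddF.
Qed.

Lemma fmean_sign j : fmean cube_weight (fun b => sign (b j)) = 0 :> R.
Proof. by apply: (@fmean_odd predT) => b; rewrite ffunE sign_neg. Qed.

Lemma fmean_sign2 j k :
  fmean cube_weight (fun b => sign (b j) * sign (b k)) = (j == k)%:R :> R.
Proof.
have [<-|jk] := eqVneq j k.
  rewrite -[RHS](fmean_cst cube_prob_weight); apply: eq_fmean => b.
  by case: (b j); rewrite /sign ?mulrNN mulr1.
apply: (@fmean_odd (pred1 j)) => b; rewrite !ffunE /= eqxx eq_sym (negbTE jk).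
by rewrite sign_neg mulNr.
Qed.

(** Multiplying the signed sum by the sign of index [j] isolates [a j] in the
    mean.  This is the bound that trades a maximum over [j] for independent
    signs. *)
Lemma le_norm_fmean_sign (a : 'I_J -> R) j :
  `|a j| <= fmean cube_weight (fun b => `|\sum_k sign (b k) * a k|).
Proof.
have -> : a j = fmean cube_weight (fun b => sign (b j) * \sum_k sign (b k) * a k).
  transitivity (fmean cube_weight
      (fun b => \sum_k sign (b j) * sign (b k) * a k)).
    rewrite fmean_sum; under eq_bigr do rewrite fmeanZr fmean_sign2.
    rewrite (bigD1 j)//= eqxx mul1r big1 ?addr0// => k kj.
    by rewrite eq_sym (negbTE kj) mul0r.
  apply: eq_fmean => b; rewrite mulr_sumr.
  by apply: eq_bigr => k _; rewrite mulrA.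
apply: le_trans (norm_fmean_le cube_prob_weight _) _.
apply: le_fmean; first exact: cube_prob_weight.
by move=> b; rewrite normrM; case: (b j); rewrite /sign ?normrN1 ?normr1 mul1r.
Qed.

Lemma fmean_sign_sqr (x : R) (a : 'I_J -> R) :
  fmean cube_weight (fun b => (x + \sum_k sign (b k) * a k) ^+ 2) =
  x ^+ 2 + \sum_k a k ^+ 2.
Proof.
transitivity (fmean cube_weight (fun b => x ^+ 2 +
    (\sum_k sign (b k) * (2 * x * a k) +
     \sum_k \sum_l sign (b k) * sign (b l) * (a k * a l)))).
  apply: eq_fmean => b; rewrite sqrrD -addrA; congr (_ + (_ + _)).
    by rewrite mulr_sumr -sumrMnl; apply: eq_bigr => k _; rewrite -mulr_natl; ring.
  rewrite expr2 mulr_suml; apply: eq_bigr => k _.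
  by rewrite mulr_sumr; apply: eq_bigr => l _; ring.
rewrite !fmeanD (fmean_cst cube_prob_weight) !fmean_sum; congr (_ + _).
rewrite big1 ?add0r => [|k _]; last by rewrite fmeanZr fmean_sign mul0r.
apply: eq_bigr => k _; rewrite fmean_sum (bigD1 k)//= big1 ?addr0 => [|l lk].
  by rewrite fmeanZr fmean_sign2 eqxx mul1r -expr2.
by rewrite fmeanZr fmean_sign2 eq_sym (negbTE lk) mul0r.
Qed.

End SignVectors.

(** * Maxima of linear forms *)

Section MaxOfLinear.
Context {R : realType}.

Lemma bounded_family_fin (T : finType) (f : T -> R) : bounded_family f.
Proof.
exists (\sum_t `|f t|) => t.
by rewrite (bigD1 t)//= lerDl sumr_ge0.
Qed.

Lemma rsupB_le (I : Type) (i0 : I) (f g : I -> R) c : bounded_family g ->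
  (forall i, f i - g i <= c) -> rsup f - rsup g <= c.
Proof.
move=> bg fg; rewrite lerBlDr; apply: (rsup_le i0) => i.
by rewrite -lerBlDr; apply: le_trans (fg i); rewrite lerD2l lerN2; exact: le_rsup.
Qed.

(** For a positive number of forms the supremum is a maximum. *)
Definition lmax (J n : nat) (u : 'I_J -> 'cV[R]_n) (v : 'cV[R]_n) : R :=
  rsup (fun j => dotv (u j) v).

Context (J n : nat) (j0 : 'I_J).
Implicit Types (u : 'I_J -> 'cV[R]_n) (v : 'cV[R]_n).

Lemma lmax0 u : lmax u 0 = 0.
Proof.
apply/eqP; rewrite eq_le; apply/andP; split.
  by apply: (rsup_le j0) => j; rewrite dotvC dotv0l.
apply: le_trans (le_rsup j0 (bounded_family_fin _)).
by rewrite dotvC dotv0l.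
Qed.

Lemma lmaxB_le u u' v v' c : (forall j, dotv (u j) v - dotv (u' j) v' <= c) ->
  lmax u v - lmax u' v' <= c.
Proof. exact: (rsupB_le j0 (bounded_family_fin _)). Qed.

Lemma norm_lmax_le u v U : (forall j, enorm (u j) <= U) ->
  `|lmax u v| <= U * enorm v.
Proof.
move=> uU; have uv j : `|dotv (u j) v| <= U * enorm v.
  by apply: le_trans (cauchy_schwarz _ _) _; rewrite ler_wpM2r ?enorm_ge0.
rewrite ler_norml; apply/andP; split; last first.
  by apply: (rsup_le j0) => j; apply: le_trans (uv j); exact: ler_norm.
apply: le_trans (le_rsup j0 (bounded_family_fin _)).
by have := uv j0; rewrite ler_norml => /andP[].
Qed.

End MaxOfLinear.

Section LinearComplexity.
Context {R : realType} (K : finType) (p : K -> R) (J n : nat)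
  (u : K -> 'I_J -> 'cV[R]_n) (U rho : R).
Hypotheses (pp : prob_weight p) (uU : forall k j, enorm (u k j) <= U).

Definition centered_ball : Type := {v : 'cV[R]_n | enorm v <= rho}.

Definition signed_sum (q : K * {ffun 'I_J -> bool}) : 'cV[R]_n :=
  \sum_j sign (q.2 j) *: u q.1 j.

Lemma fmean_enorm_signed_sum (w : 'cV[R]_n) :
  fmean (pair_weight p (@cube_weight R J)) (fun q => enorm (w + signed_sum q) ^+ 2)
  <= enorm w ^+ 2 + J%:R * U ^+ 2.
Proof.
rewrite fmean_pair -[leRHS](fmean_cst pp); apply: le_fmean => // k.
apply: (@le_trans _ _ (enorm w ^+ 2 + \sum_j enorm (u k j) ^+ 2)); last first.
  rewrite lerD2l mulr_natl -[X in _ *+ X]card_ord -sumr_const.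
  by apply: ler_sum => j _; rewrite lerXn2r ?nnegrE ?enorm_ge0// (le_trans _ (uU k j)) ?enorm_ge0.
have -> : enorm w ^+ 2 + \sum_j enorm (u k j) ^+ 2 =
    \sum_i (w i ord0 ^+ 2 + \sum_j u k j i ord0 ^+ 2).
  rewrite big_split exchange_big /=; congr (_ + _).
    by rewrite enorm_sqr; apply: eq_bigr => i _; rewrite expr2.
  apply: eq_bigr => j _.
  by rewrite enorm_sqr; apply: eq_bigr => i _; rewrite expr2.
under eq_bigr do rewrite -fmean_sign_sqr.
rewrite -fmean_sum; apply: eqW.
apply: eq_fmean => b; rewrite enorm_sqr; apply: eq_bigr => i _.
rewrite -expr2 mxE summxE; congr ((_ + _) ^+ 2).
by apply: eq_bigr => j _; rewrite mxE.
Qed.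

(** Mean square length of a random walk: independent centered steps add their
    mean squares.  The starting point [w] makes the induction go through. *)
Lemma iidmean_enorm_sqr_le M (w : 'cV[R]_n) :
  iidmean (pair_weight p (@cube_weight R J)) M
    (fun s => enorm (w + \sum_(q <- s) signed_sum q) ^+ 2)
  <= enorm w ^+ 2 + M%:R * (J%:R * U ^+ 2).
Proof.
have pW := pair_prob_weight pp (@cube_prob_weight R J).
elim: M w => [|M IH] w /=; first by rewrite big_nil addr0 mul0r addr0.
apply: (@le_trans _ _ (fmean (pair_weight p (@cube_weight R J))
    (fun q => enorm (w + signed_sum q) ^+ 2 + M%:R * (J%:R * U ^+ 2)))).
  apply: le_fmean => // q; apply: le_trans (IH _).
  by apply: le_iidmean => // s _; rewrite big_cons addrA.
rewrite fmeanD (fmean_cst pW) mulrSr mulrDl mul1r addrCA addrC lerD2r.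
exact: fmean_enorm_signed_sum.
Qed.

(** A linear form over a ball is maximised by the length of its vector, so the
    mean supremum is [2 * rho] times the mean length of the random walk. *)
Lemma linear_complexity_le M : (0 < M)%N -> (0 < J)%N -> 0 < U -> 0 <= rho ->
  iidmean (pair_weight p (@cube_weight R J)) M
    (fun s => rsup (fun v : centered_ball =>
       \sum_(q <- s) 2 * \sum_j sign (q.2 j) * dotv (u q.1 j) (sval v)))
  <= 2 * rho * U * Num.sqrt (M%:R * J%:R).
Proof.
move=> M0 J0 U0 rho0.
have pW := pair_prob_weight pp (@cube_prob_weight R J).
have v0 : centered_ball by exists 0; rewrite enorm0.
set c := U * Num.sqrt (M%:R * J%:R).
have c0 : 0 < c by rewrite mulr_gt0// sqrtr_gt0 mulr_gt0 ?ltr0n.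
have c2 : c ^+ 2 = M%:R * (J%:R * U ^+ 2).
  by rewrite exprMn sqr_sqrtr ?mulr_ge0//; ring.
apply: (@le_trans _ _ (iidmean (pair_weight p (@cube_weight R J)) M
    (fun s => rho / c * enorm (0 + \sum_(q <- s) signed_sum q) ^+ 2 + rho * c))).
  apply: le_iidmean => // s _; rewrite add0r; set W := \sum_(q <- s) _.
  apply: (@le_trans _ _ (2 * (rho * enorm W))).
    apply: (rsup_le v0) => -[v /= vrho].
    have -> : \sum_(q <- s) 2 * \sum_j sign (q.2 j) * dotv (u q.1 j) v =
        2 * dotv W v.
      rewrite -mulr_sumr; congr (_ * _); rewrite dotv_suml.
      apply: eq_bigr => q _; rewrite dotv_suml.
      by apply: eq_bigr => j _; rewrite dotvZl.
    rewrite ler_pM2l//; apply: le_trans (ler_norm _) _.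
    by apply: le_trans (cauchy_schwarz _ _) _; rewrite mulrC ler_wpM2r ?enorm_ge0.
  (* linearising the length around c, the bound on its quadratic mean *)
  have -> : rho / c * enorm W ^+ 2 + rho * c =
      rho / c * (enorm W - c) ^+ 2 + 2 * (rho * enorm W).
    by field; rewrite gt_eqF.
  by rewrite lerDr mulr_ge0 ?sqr_ge0// divr_ge0// ltW.
rewrite iidmeanD// iidmeanZ// iidmean_cst//.
apply: (@le_trans _ _ (rho / c * c ^+ 2 + rho * c)).
  rewrite lerD2r ler_wpM2l ?divr_ge0 ?(ltW c0)//.
  by apply: le_trans (iidmean_enorm_sqr_le M 0) _; rewrite enorm0 expr0n add0r c2.
have -> : 2 * rho * U * Num.sqrt (M%:R * J%:R) = 2 * rho * c by rewrite mulrA.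
by apply: eqW; field; rewrite gt_eqF.
Qed.

(** The maximum of [J] linear forms, under one random sign, is controlled by the
    forms themselves under [J] independent signs, because the largest increment
    is at most the mean absolute value of a random signed sum of all increments. *)
Lemma lmax_dominated (k : K) : (0 < J)%N ->
  0 <= rho ->
  dominated coin (@cube_weight R J)
    (fun e (v : centered_ball) => sign e * (2 * lmax (u k) (sval v)))
    (fun b v => 2 * \sum_j sign (b j) * dotv (u k j) (sval v)).
Proof.
move=> J0 rho0; have j0 : 'I_J := Ordinal J0.
have v0 : centered_ball by exists 0; rewrite enorm0.
have bdot j : bounded_family (fun v : centered_ball => dotv (u k j) (sval v)).
  exists (U * rho) => -[v /= vr]; apply: le_trans (cauchy_schwarz _ _) _.
  by rewrite ler_pM ?enorm_ge0.
apply: (contraction_dominated v0 (opp := @flip J predT)) => //.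
- exact: cube_prob_weight.
- apply: bounded_familyZ; exists (U * rho) => -[v /= vr].
  apply: le_trans (norm_lmax_le j0 v (uU k)) _.
  by rewrite ler_wpM2l// (le_trans _ (uU k j0)) ?enorm_ge0.
- move=> b; apply: bounded_familyZ; apply: bounded_family_sum => j.
  exact: bounded_familyZ.
- exact: inv_bij (@flipK J predT).
- move=> b v; rewrite -mulrN -sumrN; congr (_ * _).
  by apply: eq_bigr => j _; rewrite ffunE sign_neg mulNr.
- move=> v v'; rewrite -mulrBr.
  under eq_fmean do rewrite -mulrBr normrM ger0_norm// -sumrB.
  rewrite fmeanZ ler_pM2l//; apply: (lmaxB_le j0) => j.
  apply: le_trans (ler_norm _) _.
  have := le_norm_fmean_sign (fun j => dotv (u k j) (sval v) - dotv (u k j) (sval v')) j.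
  move=> /le_trans; apply; apply: eqW.
  apply: eq_fmean => b; congr `|_|; apply: eq_bigr => i _.
  by rewrite mulrBr.
Qed.

End LinearComplexity.

(** * Uniform deviations on a finite sample space *)

Section FiniteSample.
Context {R : realType} (K : finType) (p : K -> R) (I : Type) (i0 : I)
  (f F : K -> I -> R) (J n : nat) (u : K -> 'I_J -> 'cV[R]_n)
  (B U rho r : R) (M : nat).
Hypotheses (pp : prob_weight p) (J0 : (0 < J)%N) (M0 : (0 < M)%N)
  (U0 : 0 < U) (rho0 : 0 <= rho).
Hypothesis f0B : forall k i, 0 <= f k i <= B.
Hypothesis F_bounded : forall k, bounded_family (F k).
Hypothesis f_lip : forall k i j, `|f k i - f k j| <= `|F k i - F k j|.
Hypothesis uU : forall k j, enorm (u k j) <= U.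
(* F is a mixture of maxima of linear forms over the ball, up to the truncation
   error r per sample point *)
Hypothesis F_linear : forall (s : seq (K * bool)) i,
  \sum_(q <- s) sign q.2 * (2 * F q.1 i) <=
  rsup (fun v : @centered_ball R n rho =>
    \sum_(q <- s) sign q.2 * (2 * lmax (u q.1) (sval v))) + (size s)%:R * (2 * r).

(** Sums are not divided by the sample size, so that the summands are those of
    the domination lemmas. *)
Definition deviation (s : seq K) : R :=
  rsup (fun i => \sum_(k <- s) (fmean p (f^~ i) - f k i)).

Let f_bounded k : bounded_family (f k).
Proof. by exists B => i; have /andP[f0 fB] := f0B k i; rewrite ger0_norm. Qed.

Let f_centered_bounded k : bounded_family (fun i => fmean p (f^~ i) - f k i).
Proof.
have [C fC] := f_bounded k; exists (B + C) => i.
apply: le_trans (ler_normB _ _) _; rewrite lerD//.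
apply: (fmean_bound pp) => k'; have /andP[f0 fB] := f0B k' i.
by rewrite ger0_norm.
Qed.

Lemma le_deviation s i : \sum_(k <- s) (fmean p (f^~ i) - f k i) <= deviation s.
Proof.
exact: (le_rsup i (bounded_family_sum s f_centered_bounded)).
Qed.

(** The chain of replacements: independent copies and signs, the functions [F] in
    place of [f], points of the ball in place of the index, and finally linear
    forms in place of their maximum. *)
Lemma mean_deviation_le :
  iidmean p M deviation <=
  2 * rho * U * Num.sqrt (M%:R * J%:R) + M%:R * (2 * r).
Proof.
have pC := pair_prob_weight pp (@coin_prob_weight R).
have v0 : @centered_ball R n rho by exists 0; rewrite enorm0.
have lmax_bounded k : bounded_family
    (fun v : @centered_ball R n rho => lmax (u k) (sval v)).
  have j0 : 'I_J := Ordinal J0.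
  exists (U * rho) => -[v /= vr]; apply: le_trans (norm_lmax_le j0 v (uU k)) _.
  by rewrite ler_wpM2l// ltW.
have dom_fF : dominated p (pair_weight p coin)
    (fun k i => fmean p (f^~ i) - f k i) (fun q i => sign q.2 * (2 * F q.1 i)).
  apply: (dominated_trans (symmetrization_dominated i0 pp f_bounded)).
  apply: dominated_pair => // k.
  apply: (@contraction_dominated R I i0 bool coin negb (fun i => 2 * f k i)
    (fun e i => sign e * (2 * F k i))) => //=.
  - exact: coin_prob_weight.
  - exact: bounded_familyZ.
  - by move=> b; do 2 apply: bounded_familyZ.
  - exact: inv_bij negbK.
  - by move=> b i; rewrite sign_neg mulNr.
  - move=> i j; rewrite fmean_coin /sign -!mulrBr !normrM normrN1 normr1 ger0_norm//.
    have := f_lip k i j; have := ler_norm (f k i - f k j); lra.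
apply: le_trans (iid_dominated0 i0 M pp pC f_centered_bounded _ dom_fF) _.
  by move=> q; do 2 apply: bounded_familyZ.
apply: (@le_trans _ _ (iidmean (pair_weight p coin) M (fun s =>
    rsup (fun v : @centered_ball R n rho =>
      \sum_(q <- s) sign q.2 * (2 * lmax (u q.1) (sval v))) + M%:R * (2 * r)))).
  apply: le_iidmean => // s sM; apply: (rsup_le i0) => i.
  by rewrite -sM; exact: F_linear.
rewrite iidmeanD// iidmean_cst// lerD2r.
apply: le_trans (linear_complexity_le pp uU M0 J0 U0 rho0).
apply: (@iid_dominated0 R _ v0 (K * bool)%type (K * {ffun 'I_J -> bool})%type
  _ _ (fun q v => sign q.2 * (2 * lmax (u q.1) (sval v)))
  (fun q v => 2 * \sum_j sign (q.2 j) * dotv (u q.1 j) (sval v))) => //.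
- exact: pair_prob_weight pp (@cube_prob_weight R J).
- by move=> q; do 2 apply: bounded_familyZ.
- move=> q; apply: bounded_familyZ; apply: bounded_family_sum => j.
  apply: bounded_familyZ; exists (U * rho) => -[v /= vr].
  by apply: le_trans (cauchy_schwarz _ _) _; rewrite ler_pM ?enorm_ge0.
- by apply: dominated_pair => // k; exact: (lmax_dominated uU).
Qed.

(** One draw changes the deviation by at most [B], so McDiarmid's inequality
    applies around the mean bounded above. *)
Lemma deviation_tail (d : R) : 0 < B -> 0 <= d ->
  iidmean p M (fun s =>
    (2 * rho * U * Num.sqrt (M%:R * J%:R) + M%:R * (2 * r) + d < deviation s)%R%:R)
  <= expR (- (2 * d ^+ 2 / (M%:R * B ^+ 2))).
Proof.
move=> B0 d0; apply: le_trans (bounded_difference_tail pp M0 B0 d0 _).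
  apply: (le_iidmean pp) => s _; rewrite ler_nat.
  case: ltP => // lt; case: ltP => // /(lt_le_trans lt).
  by rewrite ltrD2r ltNge mean_deviation_le.
move=> s1 a b s2; apply: (rsupB_le i0).
  exact: bounded_family_sum.
move=> i; rewrite !big_cat !big_cons /=.
have /andP[? ?] := f0B a i; have /andP[? ?] := f0B b i; lra.
Qed.

End FiniteSample.

(** * The loss in homogeneous coordinates, Borel sets and discretization *)

Section LossBounds.
Context {R : realType} (J Dx Dxi : nat) (L : pwa R J Dx Dxi) (j0 : 'I_J).
Implicit Types (x : 'cV[R]_Dx) (xi : 'cV[R]_Dxi).

Definition pwa_opnorm : R := ord_maxr (fun j => opnorm (pwa_block L j)).

Definition loss_dir x (j : 'I_J) : 'cV[R]_(Dxi + 1) :=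
  (pwa_block L j)^T *m homog x.

Lemma lossE x xi : loss L x xi = lmax (loss_dir x) (homog xi).
Proof.
rewrite /loss /lmax -[LHS]/(rsup _); congr rsup; apply/funext => j.
rewrite dotvE /loss_dir trmx_mul trmxK -mulmxA /pwa_block /homog.
rewrite mul_block_col tr_col_mx mul_row_col tr_scalar_mx mul1mx !mulmx1.
rewrite /pwa_slope /pwa_offset linearD /= trmx_mul !mulmxDl mulmxDr !mulmxA.
rewrite !mxE eqxx mulr1n addrACA -!addrA; congr (_ + _).
rewrite addrCA [in RHS]addrCA; congr (_ + (_ + _)).
by apply: eq_bigr => i _; rewrite !mxE mulrC.
Qed.

Lemma pwa_opnorm_ge j : opnorm (pwa_block L j) <= pwa_opnorm.
Proof. exact: le_rsup (bounded_family_fin _). Qed.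

Lemma pwa_opnorm_ge0 : 0 <= pwa_opnorm.
Proof. exact: le_trans (opnorm_ge0 _) (pwa_opnorm_ge j0). Qed.

Lemma enorm_loss_dir_le x j :
  enorm (loss_dir x j) <= pwa_opnorm * Num.sqrt (enorm x ^+ 2 + 1).
Proof.
apply: le_trans (le_opnorm_tr _ _) _.
by rewrite enorm_homog ler_wpM2r ?sqrtr_ge0 ?pwa_opnorm_ge.
Qed.

Lemma norm_loss_le x xi : `|loss L x xi| <=
  pwa_opnorm * Num.sqrt (enorm x ^+ 2 + 1) * Num.sqrt (enorm xi ^+ 2 + 1).
Proof.
by rewrite lossE -(enorm_homog xi); apply: (norm_lmax_le j0) => j; exact: enorm_loss_dir_le.
Qed.

Lemma homogB n (y y' : 'cV[R]_n) : homog y - homog y' = col_mx (y - y') 0.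
Proof. by rewrite /homog opp_col_mx add_col_mx subrr. Qed.

Lemma enorm_homogB n (y y' : 'cV[R]_n) : enorm (homog y - homog y') = enorm (y - y').
Proof.
rewrite homogB /enorm big_split_ord/= big_ord1 col_mxEd mxE expr0n addr0.
by congr Num.sqrt; apply: eq_bigr => i _; rewrite col_mxEu.
Qed.

Lemma lossBl_le x x' xi : loss L x xi - loss L x' xi <=
  pwa_opnorm * enorm (x - x') * Num.sqrt (enorm xi ^+ 2 + 1).
Proof.
rewrite !lossE -(enorm_homog xi); apply: (lmaxB_le j0) => j.
rewrite -dotvBl -mulmxBr; apply: le_trans (ler_norm _) _.
apply: le_trans (cauchy_schwarz _ _) _; rewrite ler_wpM2r ?enorm_ge0//.
apply: le_trans (le_opnorm_tr _ _) _.
by rewrite enorm_homogB ler_wpM2r ?enorm_ge0 ?pwa_opnorm_ge.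
Qed.

Lemma lossBr_le x xi xi' : loss L x xi - loss L x xi' <=
  pwa_opnorm * Num.sqrt (enorm x ^+ 2 + 1) * enorm (xi - xi').
Proof.
rewrite !lossE; apply: (lmaxB_le j0) => j.
rewrite -dotvBr; apply: le_trans (ler_norm _) _.
apply: le_trans (cauchy_schwarz _ _) _.
by rewrite enorm_homogB ler_wpM2r ?enorm_ge0 ?enorm_loss_dir_le.
Qed.

Lemma sqrt_sqr1_le (t : R) : Num.sqrt (t ^+ 2 + 1) <= 1 + t ^+ 2.
Proof.
have t1 : 0 <= 1 + t ^+ 2 by rewrite addr_ge0 ?sqr_ge0.
rewrite -[leRHS]ger0_norm// -sqrtr_sqr ler_sqrt ?sqr_ge0//.
by have := sqr_ge0 t; set u := t ^+ 2 => u0; nra.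
Qed.

End LossBounds.

Section Borel.
Context {R : realType} {n : nat}.

Lemma enorm_le_norm (y : 'cV[R]_n) : enorm y <= n%:R * `|y|.
Proof.
have {1}-> : y = \sum_i (y i ord0) *: delta_mx i ord0.
  by rewrite [LHS]matrix_sum_delta; apply: eq_bigr => i _; rewrite big_ord1.
apply: le_trans (enorm_sum _ _) _.
rewrite -[X in _ <= X%:R * _]card_ord mulr_natl -sumr_const.
apply: ler_sum => i _; rewrite enormZ.
have -> : enorm (delta_mx i ord0 : 'cV[R]_n) = 1.
  rewrite /enorm (bigD1 i)//= mxE !eqxx expr1n big1 ?addr0 ?sqrtr1// => k ki.
  by rewrite mxE (negbTE ki) expr0n.
rewrite mulr1 [in leRHS]/Num.Def.normr/= mx_normrE.
exact: (le_bigmax _ (fun ij => `|y ij.1 ij.2|) (i, ord0)).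
Qed.

Lemma lipschitz_continuous (f : 'cV[R]_n -> R) c :
  (forall y y', f y - f y' <= c * enorm (y - y')) -> continuous f.
Proof.
move=> fc y; apply/(@cvgrPdist_lt _ _ _ (nbhs y) (nbhs_filter y) f (f y)) => e e0.
pose k := `|c| * n%:R + 1.
have k0 : 0 < k by rewrite ltr_wpDl// mulr_ge0.
have fk y1 y2 : f y1 - f y2 <= (k - 1) * `|y1 - y2|.
  apply: le_trans (fc y1 y2) _; rewrite /k addrK -mulrA.
  apply: (@le_trans _ _ (`|c| * enorm (y1 - y2))).
    by rewrite ler_wpM2r ?enorm_ge0 ?ler_norm.
  by rewrite ler_wpM2l ?enorm_le_norm.
near=> y'.
have dy : `|y - y'| < e / k by near: y'; apply: cvgr_dist_lt; [exact: cvg_id|exact: divr_gt0].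
apply: (@le_lt_trans _ _ ((k - 1) * `|y - y'|)).
  by rewrite ler_norml lerNl opprB fk distrC fk.
apply: (@le_lt_trans _ _ (k * `|y - y'|)).
  by rewrite ler_wpM2r// gerBl.
by rewrite mulrC -ltr_pdivlMr.
Unshelve. all: by end_near. Qed.

(** The Borel sets of [vec] come from the product topology, so this is how the
    Euclidean norm meets the measurable structure. *)
Lemma lipschitz_measurable (f : 'cV[R]_n -> R) c :
  (forall y y', f y - f y' <= c * enorm (y - y')) ->
  measurable_fun setT (f : vec R n -> R).
Proof.
move=> /lipschitz_continuous/continuousP cf.
apply: (measurability _ (RGenOpens.measurableE R)).
move=> _ [_ [a [b ->] <-]]; rewrite setTI; apply: sub_sigma_algebra.
exact/cf/interval_open.
Qed.

Lemma enorm_measurable : measurable_fun setT (@enorm R n : vec R n -> R).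
Proof.
apply: (@lipschitz_measurable _ 1) => y y'; rewrite mul1r.
exact: le_trans (ler_norm _) (enorm_distl _ _).
Qed.

Lemma open_eball (c : 'cV[R]_n) (e : R) : open [set y | enorm (y - c) < e].
Proof.
have /continuousP cf : continuous (fun y : 'cV[R]_n => enorm (y - c)).
  apply: (@lipschitz_continuous _ 1) => y y'; rewrite mul1r.
  apply: le_trans (ler_norm _) _; apply: le_trans (enorm_distl _ _) _.
  by rewrite opprB addrA subrK.
exact: (cf _ (@open_lt _ e)).
Qed.

Lemma eball_center (c : 'cV[R]_n) (e : R) : 0 < e -> enorm (c - c) < e.
Proof. by rewrite subrr enorm0. Qed.

Lemma measurable_find (s : seq 'cV[R]_n) (e : R) (k : nat) :
  measurable ([set y | find (fun c => enorm (y - c) < e) s = k] : set (vec R n)).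
Proof.
elim: s k => [|c s IH] k /=.
  have [->|k0] := eqVneq k 0%N.
    by rewrite (_ : [set _ | _] = setT)//; apply/seteqP; split.
  rewrite (_ : [set _ | _] = set0)//; apply/seteqP; split => // y /= /esym/eqP.
  by rewrite (negbTE k0).
have mB : measurable ([set y | enorm (y - c) < e] : set (vec R n)).
  by apply: sub_sigma_algebra; exact: open_eball.
case: k => [|k].
  rewrite (_ : [set _ | _] = [set y | enorm (y - c) < e])//.
  by apply/seteqP; split => y /=; case: ifP.
rewrite (_ : [set _ | _] = ~` [set y | enorm (y - c) < e] `&`
    [set y | find (fun c => enorm (y - c) < e) s = k]).
  by apply: measurableI => //; exact: measurableC.
apply/seteqP; split => y /=; case: (boolP (enorm (y - c) < e)) => yc //.
- by move=> [].
- by move=> [].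
- by move=> [_ ->].
Qed.

(** A finite subcover by small balls, made disjoint by sending a point to the
    first center that is close to it.  Points close to no center, all outside
    [X], get the extra index, whose representative is the default [x0]. *)
Lemma compact_discretization (X : set 'cV[R]_n) (x0 : 'cV[R]_n) (e : R) :
  compact X -> X x0 -> 0 < e ->
  exists (K : nat) (x : 'I_K.+1 -> 'cV[R]_n) (cell : vec R n -> 'I_K.+1),
  [/\ forall k, X (x k), forall k, measurable (cell @^-1` [set k]) &
      forall y, X y -> enorm (y - x (cell y)) < e].
Proof.
move=> cX Xx0 e0; move: cX; rewrite compact_cover => cX.
have [D DX XD] := cX _ X (fun c => [set y | enorm (y - c) < e])
  (fun c _ => @open_eball c e)
  (fun y Xy => ex_intro2 _ _ y Xy (eball_center y e0)).
pose s : seq (matrix R n 1) := finmap.enum_fset D.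
have sX c : c \in s -> X c by move=> cs; have := DX c cs; rewrite inE.
pose near y := find (fun c => enorm (y - c) < e) s.
have nearK y : (near y < (size s).+1)%N by rewrite ltnS find_size.
exists (size s), (fun k => nth x0 s k), (fun y => Ordinal (nearK y)).
split.
- move=> k; have [ks|sk] := ltnP k (size s); last by rewrite nth_default.
  exact/sX/mem_nth.
- move=> k; rewrite (_ : _ @^-1` _ = [set y | near y = k]).
    exact: measurable_find.
  by apply/seteqP; split => y /= => [<-//|yk]; exact: val_inj.
- move=> y Xy /=; have [c cD yc] := XD y Xy.
  apply: (nth_find x0 (a := fun c => enorm (y - c) < e)).
  by apply/hasP; exists c.
Qed.

Lemma compact_measurable (X : set 'cV[R]_n) :
  compact X -> measurable (X : set (vec R n)).
Proof.
move=> cX; rewrite -[X]setCK; apply: measurableC; apply: sub_sigma_algebra.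
by apply: closed_openC; apply: compact_closed => //; exact: norm_hausdorff.
Qed.

Lemma probability1_nonempty (Z : probability (vec R n) R) (X : set 'cV[R]_n) :
  Z X = 1%E -> exists x, X x.
Proof.
move=> ZX; apply/set0P/eqP => X0; move: ZX; rewrite X0 measure0 => /eqP.
by rewrite eq_sym onee_eq0.
Qed.

End Borel.

(** * Expectations under a second moment bound *)

Section Moments.
Context {R : realType} {n : nat} (Q : probability (vec R n) R) (Om : R).
Hypothesis Q2 : (second_moment Q <= Om%:E)%E.

(** The real-valued mean of the excess loss; on functions of quadratic growth it
    is linear and monotone. *)
Definition mean (f : 'cV[R]_n -> R) : R := fine 'E_Q[f].

Definition quadratic_growth (f : 'cV[R]_n -> R) : Prop :=
  measurable_fun setT (f : vec R n -> R) /\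
  exists D, forall xi, `|f xi| <= D * (1 + enorm xi ^+ 2).

Lemma enorm_sqr_measurable :
  measurable_fun setT (fun xi : vec R n => enorm xi ^+ 2).
Proof. by apply: measurable_funX; exact: enorm_measurable. Qed.

Lemma quadratic_growthD f g : quadratic_growth f -> quadratic_growth g ->
  quadratic_growth (fun xi => f xi + g xi).
Proof.
move=> [mf [D fD]] [mg [E gE]]; split; first exact: measurable_funD.
exists (D + E) => xi; rewrite mulrDl.
by apply: le_trans (ler_normD _ _) _; rewrite lerD.
Qed.

Lemma quadratic_growthZ c f : quadratic_growth f ->
  quadratic_growth (fun xi => c * f xi).
Proof.
move=> [mf [D fD]]; split; first exact: measurable_funM.
by exists (`|c| * D) => xi; rewrite normrM -mulrA ler_wpM2l.
Qed.

Lemma quadratic_growth_cst c : quadratic_growth (fun=> c).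
Proof.
split; first exact: measurable_cst.
by exists `|c| => xi; rewrite ler_peMr// lerDl sqr_ge0.
Qed.

Lemma quadratic_growth_enorm_sqr : quadratic_growth (fun xi => enorm xi ^+ 2).
Proof.
split; first exact: enorm_sqr_measurable.
by exists 1 => xi; rewrite mul1r ger0_norm ?sqr_ge0// lerDr.
Qed.

Lemma quadratic_growth_indic (A : set (vec R n)) : measurable A ->
  quadratic_growth (\1_A : vec R n -> R).
Proof.
move=> mA; split; first exact: measurable_indic.
exists 1 => xi; rewrite mul1r indicE ger0_norm ?ler0n//.
by apply: (@le_trans _ _ 1); [case: (_ \in _)|rewrite lerDl sqr_ge0].
Qed.

Lemma quadratic_growth_sum (T : Type) (s : seq T) (f : T -> 'cV[R]_n -> R) :
  (forall a, quadratic_growth (f a)) ->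
  quadratic_growth (fun xi => \sum_(a <- s) f a xi).
Proof.
move=> qf; elim: s => [|a s IH].
  by under eq_fun do rewrite big_nil; exact: quadratic_growth_cst.
by under eq_fun do rewrite big_cons; exact: quadratic_growthD.
Qed.

Lemma second_momentE : second_moment Q = (\int[Q]_xi (enorm xi ^+ 2)%:E)%E.
Proof. by rewrite /second_moment unlock. Qed.

Lemma integrable_enorm_sqr :
  Q.-integrable setT (EFin \o (fun xi : vec R n => enorm xi ^+ 2)).
Proof.
apply/integrableP; split.
  by apply/measurable_EFinP; exact: enorm_sqr_measurable.
under eq_integral do rewrite /= ger0_norm ?sqr_ge0//.
by rewrite -second_momentE; apply: le_lt_trans Q2 _; rewrite ltry.
Qed.

Lemma quadratic_growth_integrable f : quadratic_growth f ->
  Q.-integrable setT (EFin \o (f : vec R n -> R)).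
Proof.
move=> [mf [D fD]].
apply: (@le_integrable _ _ _ Q setT measurableT _
  (EFin \o (fun xi : vec R n => D * (1 + enorm xi ^+ 2)))).
- exact/measurable_EFinP.
- move=> xi _; rewrite /= lee_fin.
  by apply: le_trans (fD xi) _; exact: ler_norm.
have -> : EFin \o (fun xi : vec R n => D * (1 + enorm xi ^+ 2)) =
    (fun xi : vec R n => D%:E * (1%:E + (enorm xi ^+ 2)%:E))%E.
  by apply/funext => xi.
apply: integrableZl => //; apply: integrableD => //.
  exact: finite_measure_integrable_cst.
exact: integrable_enorm_sqr.
Qed.

Lemma meanE f : mean f = \int[Q]_xi f xi.
Proof. by rewrite /mean unlock. Qed.

Lemma le_mean f g : quadratic_growth f -> quadratic_growth g ->
  (forall xi, f xi <= g xi) -> mean f <= mean g.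
Proof.
move=> qf qg fg; rewrite !meanE.
by apply: le_Rintegral => //; exact: quadratic_growth_integrable.
Qed.

Lemma meanD f g : quadratic_growth f -> quadratic_growth g ->
  mean (fun xi => f xi + g xi) = mean f + mean g.
Proof.
move=> qf qg; rewrite !meanE.
by apply: RintegralD => //; exact: quadratic_growth_integrable.
Qed.

Lemma meanZ c f : quadratic_growth f -> mean (fun xi => c * f xi) = c * mean f.
Proof.
move=> qf; rewrite !meanE.
by apply: RintegralZl => //; exact: quadratic_growth_integrable.
Qed.

Lemma mean_cst c : mean (fun=> c) = c.
Proof.
rewrite /mean -[fun=> c]/(cst c : vec R n -> R).
by rewrite expectation_cst.
Qed.

Lemma mean_indic (A : set (vec R n)) : measurable A -> mean (\1_A) = fine (Q A).
Proof. by move=> mA; rewrite /mean expectation_indic. Qed.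

Lemma mean_sum (T : Type) (s : seq T) (f : T -> 'cV[R]_n -> R) :
  (forall a, quadratic_growth (f a)) ->
  mean (fun xi => \sum_(a <- s) f a xi) = \sum_(a <- s) mean (f a).
Proof.
move=> qf; elim: s => [|a s IH].
  by under eq_fun do rewrite big_nil; rewrite mean_cst big_nil.
under eq_fun do rewrite big_cons; rewrite big_cons -IH meanD//.
exact: quadratic_growth_sum.
Qed.

Lemma mean_enorm_sqr_le : mean (fun xi => enorm xi ^+ 2) <= Om.
Proof.
have := quadratic_growth_integrable quadratic_growth_enorm_sqr.
move=> /(integrable_fin_num measurableT) fin.
by rewrite -lee_fin /mean fineK ?unlock//; move: Q2; rewrite second_momentE.
Qed.

Lemma norm_mean_le f a b : 0 < Om -> quadratic_growth f -> 0 <= b ->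
  (forall xi, `|f xi| <= a + b * enorm xi) ->
  `|mean f| <= a + b * Num.sqrt Om.
Proof.
move=> Om0 qf b0 fab; set s := Num.sqrt Om.
have s0 : 0 < s by rewrite sqrtr_gt0.
have ss : s ^+ 2 = Om by rewrite sqr_sqrtr// ltW.
have qg := quadratic_growthD (quadratic_growth_cst (a + b * s / 2))
  (quadratic_growthZ (b / (2 * s)) quadratic_growth_enorm_sqr).
have fg xi : `|f xi| <= a + b * s / 2 + b / (2 * s) * enorm xi ^+ 2.
  apply: le_trans (fab xi) _; rewrite -subr_ge0.
  (* linearising the norm around the root of Om, instead of Cauchy-Schwarz *)
  have -> : a + b * s / 2 + b / (2 * s) * enorm xi ^+ 2 - (a + b * enorm xi) =
      b / (2 * s) * (enorm xi - s) ^+ 2 by field; rewrite gt_eqF.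
  by rewrite mulr_ge0 ?sqr_ge0// divr_ge0// mulr_ge0// ltW.
have gs : mean (fun xi => a + b * s / 2 + b / (2 * s) * enorm xi ^+ 2) <=
    a + b * s.
  rewrite meanD; [|exact: quadratic_growth_cst|
    exact/quadratic_growthZ/quadratic_growth_enorm_sqr].
  rewrite mean_cst meanZ; last exact: quadratic_growth_enorm_sqr.
  apply: (@le_trans _ _ (a + b * s / 2 + b / (2 * s) * Om)).
    by rewrite lerD2l ler_wpM2l ?mean_enorm_sqr_le// divr_ge0// mulr_ge0// ltW.
  rewrite -ss; apply: eqW; field.
  by rewrite gt_eqF.
rewrite ler_norml; apply/andP; split.
  rewrite lerNl; apply: le_trans gs.
  rewrite -mulN1r -meanZ//; apply: le_mean => //.
    exact: quadratic_growthZ.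
  by move=> xi; rewrite mulN1r; apply: le_trans (fg xi); rewrite -normrN ler_norm.
apply: le_trans gs; apply: le_mean => // xi.
by apply: le_trans (fg xi); exact: ler_norm.
Qed.

(** The ball of radius [t] misses a mass of at most [q], and there the linear bound
    is paid for by the second moment, as in Cauchy-Schwarz. *)
Lemma mean_truncated_le f S k c1 c2 t q : 0 < Om -> 0 < q -> quadratic_growth f ->
  0 <= k -> 0 <= c1 -> 0 <= c2 ->
  ((1 - q)%:E <= Q [set xi : vec R n | (enorm xi <= t)%R])%E ->
  (forall xi, enorm xi <= t -> f xi <= S) ->
  (forall xi, f xi <= S + k * (c1 + c2 * enorm xi)) ->
  mean f <= S + k * (c1 * q + c2 * Num.sqrt (q * Om)).
Proof.
move=> Om0 q0 qf k0 c10 c20 Qt fS fSk.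
set s := Num.sqrt (q * Om).
have s0 : 0 < s by rewrite sqrtr_gt0 mulr_gt0.
have ss : s ^+ 2 = q * Om by rewrite sqr_sqrtr// mulr_ge0// ltW.
pose A := [set xi : vec R n | enorm xi <= t].
have mA : measurable A.
  have := @enorm_measurable R n measurableT _ (measurable_itv `]-oo, t]).
  by rewrite setTI (_ : _ @^-1` _ = A)//; apply/seteqP; split => xi /=; rewrite in_itv.
have mAC : measurable (~` A) by exact: measurableC.
have QAC : mean (\1_(~` A)) <= q.
  rewrite mean_indic// -lee_fin fineK ?fin_num_measure// probability_setC//.
  move: Qt; rewrite -/A -(fineK (fin_num_measure Q A mA)) -EFinB !lee_fin.
  by lra.
(* the weight that balances the second moment against the missing mass *)
pose al := s / Om.
have al0 : 0 < al by rewrite divr_gt0.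
have ka0 : 0 <= k * c2 * al / 2.
  by rewrite divr_ge0//; apply: mulr_ge0; [exact: mulr_ge0|exact: ltW].
have kb0 : 0 <= k * c2 / (2 * al).
  by apply: divr_ge0; apply: mulr_ge0 => //; exact: ltW.
pose g (xi : 'cV[R]_n) := S + (k * (c1 + c2 / (2 * al)) * \1_(~` A) xi +
  k * c2 * al / 2 * enorm xi ^+ 2).
have fg xi : f xi <= g xi.
  rewrite /g indicE; have [xit|xit] := leP (enorm xi) t.
    rewrite memNset ?mulr0 ?add0r; last by move=> /=; apply.
    apply: le_trans (fS xi xit) _.
    by rewrite lerDl; apply: mulr_ge0 => //; exact: sqr_ge0.
  rewrite mem_set ?mulr1; last by move=> /=; apply/negP; rewrite -ltNge.
  apply: le_trans (fSk xi) _; rewrite lerD2l -subr_ge0.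
  have -> : k * (c1 + c2 / (2 * al)) + k * c2 * al / 2 * enorm xi ^+ 2 -
      k * (c1 + c2 * enorm xi) =
      k * c2 / (2 * al) * (al * enorm xi - 1) ^+ 2 by field; rewrite gt_eqF.
  by apply: mulr_ge0 => //; exact: sqr_ge0.
have q1 := quadratic_growthZ (k * (c1 + c2 / (2 * al))) (quadratic_growth_indic mAC).
have q2 := quadratic_growthZ (k * c2 * al / 2) quadratic_growth_enorm_sqr.
have q12 := quadratic_growthD q1 q2.
have qg : quadratic_growth g := quadratic_growthD (quadratic_growth_cst S) q12.
apply: le_trans (le_mean qf qg fg) _.
rewrite /g meanD//; last exact: quadratic_growth_cst.
rewrite mean_cst lerD2l meanD// !meanZ//; last 2 first.
- exact: quadratic_growth_enorm_sqr.
- exact: quadratic_growth_indic.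
apply: (@le_trans _ _ (k * (c1 + c2 / (2 * al)) * q + k * c2 * al / 2 * Om)).
  apply: lerD; rewrite ler_wpM2l ?mean_enorm_sqr_le//.
  by rewrite mulr_ge0// addr_ge0// divr_ge0// mulr_ge0// ltW.
have qE : q = s ^+ 2 / Om by rewrite ss mulfK ?gt_eqF.
have -> : c1 + c2 / (2 * al) = c1 + c2 * Om / (2 * s).
  by rewrite /al; field; rewrite !gt_eqF.
rewrite mulrDr mulrDl. rewrite [in X in _ + X + _]qE /al.
apply: eqW; field.
by rewrite !gt_eqF.
Qed.

End Moments.

(** * Sampling from finitely many cells *)

Section Sampling.
Context {R : realType}.

Lemma preimage_fibers (T : Type) (A : finType) (Y : T -> A) (G : pred A) :
  Y @^-1` [set a | G a] = \bigcup_(a in [set a | G a]) Y @^-1` [set a].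
Proof. by apply/seteqP; split => w /= => [Gw|[a /= Ga ->]//]; exists (Y w). Qed.

Lemma measurable_preimage_fin d (T : measurableType d) (A : finType) (Y : T -> A)
    (G : pred A) :
  (forall a, measurable (Y @^-1` [set a])) -> measurable (Y @^-1` [set a | G a]).
Proof.
by move=> mY; rewrite preimage_fibers; exact: fin_bigcup_measurable.
Qed.

Lemma measure_fibers d (T : measurableType d) (mu : probability T R)
    (A : finType) (Y : T -> A) (G : pred A) :
  (forall a, measurable (Y @^-1` [set a])) ->
  mu (Y @^-1` [set a | G a]) = (\sum_(a | G a) mu (Y @^-1` [set a]))%E.
Proof.
move=> mY.
rewrite preimage_fibers measure_fin_bigcup//.
- apply/esym; apply: bigfs; first exact: index_enum_uniq.
  by move=> a _; rewrite mem_index_enum.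
- exact: finite_finset.
- exact: trivIset_preimage1.
Qed.

Lemma sum_fibers d (T : measurableType d) (mu : probability T R)
    (A : finType) (Y : T -> A) :
  (forall a, measurable (Y @^-1` [set a])) ->
  prob_weight (fun a => fine (mu (Y @^-1` [set a]))).
Proof.
move=> mY; split=> [a|]; first exact: fine_ge0.
have := measure_fibers mu (pred_of_simpl predT) mY; rewrite (_ : _ @^-1` _ = setT); last first.
  by apply/seteqP; split.
rewrite probability_setT => S1; apply: EFin_inj; rewrite S1 -sumEFin.
by apply: eq_bigr => a _; rewrite fineK ?fin_num_measure.
Qed.

(** Discretization of an expectation: on each cell the function is replaced by its
    value at the representative, at the cost [e]. *)
Lemma expectation_le_fibers n (Z : probability (vec R n) R) (X : set 'cV[R]_n)
    (K : finType) (x : K -> 'cV[R]_n) (cell : vec R n -> K) (f : 'cV[R]_n -> R)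
    (e : R) :
  (forall k, measurable (cell @^-1` [set k])) ->
  measurable (X : set (vec R n)) -> Z X = 1%E ->
  measurable_fun setT (f : vec R n -> R) -> (forall y, 0 <= f y) -> 0 <= e ->
  (forall y, X y -> f y <= f (x (cell y)) + e) ->
  ('E_Z[f] <= (fmean (fun k => fine (Z (cell @^-1` [set k]))) (f \o x) + e)%:E)%E.
Proof.
move=> mcell mX ZX mf f0 e0 fX.
pose g (y : vec R n) : \bar R := (\sum_k (f (x k))%:E * (\1_(cell @^-1` [set k]) y)%:E)%E.
have gE y : g y = (f (x (cell y)))%:E.
  rewrite /g (bigD1 (cell y))//= big1 ?adde0 => [|k kc]; last first.
    rewrite indicE memNset ?mule0//= => /esym /eqP; exact/negP.
  by rewrite indicE mem_set// mule1.
have mg k : measurable_fun setT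
    (fun y : vec R n => (f (x k))%:E * (\1_(cell @^-1` [set k]) y)%:E)%E.
  apply: emeasurable_funM => //; apply/measurable_EFinP.
  exact: measurable_indic.
have g0 k (y : vec R n) : setT y ->
    (0 <= (f (x k))%:E * (\1_(cell @^-1` [set k]) y)%:E)%E.
  by move=> _; rewrite -EFinM lee_fin mulr_ge0// indicE ler0n.
have intg : (\int[Z]_y g y = \sum_k (f (x k))%:E * Z (cell @^-1` [set k]))%E.
  rewrite /g ge0_integral_sum//; apply: eq_bigr => k _.
  rewrite ge0_integralZl ?lee_fin//.
  - by rewrite integral_indic// setIT.
  - apply/measurable_EFinP; exact: measurable_indic.
have mgs : measurable_fun setT g by exact: emeasurable_sum.
rewrite unlock; apply: (@le_trans _ _ (\int[Z]_y (g y + e%:E))%E).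
  apply: ae_ge0_le_integral => //.
  - by move=> y _; rewrite lee_fin.
  - exact/measurable_EFinP.
  - by move=> y _; rewrite gE -EFinD lee_fin addr_ge0.
  - exact: emeasurable_funD.
  exists (~` X); split.
  - exact: measurableC.
  - have : Z (~` X) = 0%E by rewrite probability_setC// ZX subee.
    by [].
  - move=> y /=; apply: contra_not => Xy _.
    by rewrite gE -EFinD lee_fin fX.
rewrite ge0_integralD//; last by move=> y _; rewrite gE lee_fin.
rewrite integral_cst//= probability_setT mule1 intg EFinD leeD2r//.
rewrite /fmean -sumEFin; apply: eqW.
apply: eq_bigr => k _; rewrite /= EFinM fineK ?fin_num_measure// muleC//.
Qed.

(** The cells visited by an independent sample have the product law, so that their
    probabilities are those of finite sampling. *)
Lemma iid_discrete_law d (T : measurableType d) (P : probability T R) (n M : nat)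
    (z : 'I_M -> {RV P >-> vec R n}) (Z : probability (vec R n) R)
    (K : finType) (cell : vec R n -> K) (G : pred (seq K)) :
  (forall k, measurable (cell @^-1` [set k])) -> iid_from z Z ->
  let sample w := [tuple cell (z m w) | m < M] in
  measurable [set w | G (sample w)] /\
  P [set w | G (sample w)] =
    (iidmean (fun k => fine (Z (cell @^-1` [set k]))) M (fun s => (G s)%:R))%:E.
Proof.
move=> mcell [law indep] sample.
have fiberE (t : M.-tuple K) : sample @^-1` [set t] =
    [set w | forall m, m \in [set: 'I_M]%SET -> (cell @^-1` [set tnth t m]) (z m w)].
  apply/seteqP; split => w /=.
    by move=> <- m _; rewrite tnth_mktuple.
  by move=> H; apply: eq_from_tnth => m; rewrite tnth_mktuple; apply: H; rewrite inE.
have mz m k : measurable (z m @^-1` (cell @^-1` [set k])).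
  by rewrite -[X in measurable X]setTI; apply: measurable_funP.
have mfiber t : measurable (sample @^-1` [set t]).
  rewrite fiberE (_ : [set w | _] =
    \bigcap_(m in [set: 'I_M]) (z m @^-1` (cell @^-1` [set tnth t m]))).
    by apply: fin_bigcap_measurable => // m _.
  by apply/seteqP; split => w /= H m => [_|_]; apply: H; rewrite ?inE.
have Pfiber t : P (sample @^-1` [set t]) =
    (\prod_(k <- t) fine (Z (cell @^-1` [set k])))%:E.
  rewrite fiberE.
  rewrite (indep [set: 'I_M]%SET (fun m => cell @^-1` [set tnth t m]))//.
  rewrite big_tuple.
  rewrite (eq_bigl xpredT); last by move=> m; rewrite inE.
  rewrite -prodEFin; apply: eq_bigr => m _.
  by rewrite fineK ?fin_num_measure// -(law m).
have -> : [set w | G (sample w)] = sample @^-1` [set t : M.-tuple K | G t] by [].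
split.
  exact: (measurable_preimage_fin (fun t : M.-tuple K => G t) mfiber).
rewrite (measure_fibers P (fun t : M.-tuple K => G t) mfiber) iidmeanE.
rewrite -sumEFin [RHS](bigID (fun t : M.-tuple K => G t)) /=.
rewrite [X in (_ + X)%E]big1 ?adde0; last first.
  by move=> t /negbTE ->; rewrite mulr0.
by apply: eq_bigr => t Gt; rewrite Pfiber Gt mulr1.
Qed.

End Sampling.

(** * Mean loss and excess loss *)

Section LossMeans.
Context {R : realType} (J Dx Dxi : nat) (L : pwa R J Dx Dxi) (j0 : 'I_J)
  (Om : R).
Hypothesis Om0 : 0 < Om.
Implicit Types (Q : probability (vec R Dxi) R) (x : 'cV[R]_Dx).

Lemma loss_quadratic_growth x : quadratic_growth (loss L x).
Proof.
split; first exact: lipschitz_measurable (lossBr_le L j0 x).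
exists (pwa_opnorm L * Num.sqrt (enorm x ^+ 2 + 1)) => xi.
apply: le_trans (norm_loss_le L j0 x xi) _.
by rewrite ler_wpM2l ?sqrt_sqr1_le// mulr_ge0 ?sqrtr_ge0 ?(pwa_opnorm_ge0 L j0).
Qed.

Lemma mean_lossB_le Q x x' : (second_moment Q <= Om%:E)%E ->
  mean Q (loss L x) - mean Q (loss L x') <=
  pwa_opnorm L * (1 + Om) * enorm (x - x').
Proof.
move=> Q2; have L0 := pwa_opnorm_ge0 L j0.
set c := pwa_opnorm L * enorm (x - x').
have c0 : 0 <= c by rewrite mulr_ge0 ?enorm_ge0.
have q1 : quadratic_growth (fun xi : 'cV[R]_Dxi => 1 + enorm xi ^+ 2).
  exact: quadratic_growthD (quadratic_growth_cst 1) (@quadratic_growth_enorm_sqr R Dxi).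
have qc := quadratic_growthZ c q1.
have qx := loss_quadratic_growth x; have qx' := loss_quadratic_growth x'.
rewrite lerBlDl.
apply: (@le_trans _ _ (mean Q (fun xi => loss L x' xi + c * (1 + enorm xi ^+ 2)))).
  apply: (le_mean Q2) => //; first exact: quadratic_growthD.
  move=> xi; rewrite -lerBlDl; apply: le_trans (lossBl_le L j0 x x' xi) _.
  by rewrite ler_wpM2l ?sqrt_sqr1_le.
rewrite (meanD Q2)// lerD2l (meanZ Q2)// (meanD Q2); [|exact: quadratic_growth_cst|
  exact: quadratic_growth_enorm_sqr].
rewrite mean_cst [leRHS]mulrAC -/c ler_wpM2l// lerD2l.
exact: mean_enorm_sqr_le.
Qed.

Lemma pos_part_ge0 (a : R) : 0 <= pos_part a.
Proof. by rewrite le_max lexx orbT. Qed.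

Lemma pos_part_le (a : R) b : 0 <= b -> a <= b -> pos_part a <= b.
Proof. by move=> b0 ab; rewrite ge_max ab. Qed.

Lemma pos_partB_le (a b : R) : pos_part a - pos_part b <= `|a - b|.
Proof.
rewrite lerBlDr; apply: pos_part_le; first by rewrite addr_ge0 ?pos_part_ge0.
have : b <= pos_part b by rewrite le_max lexx.
have := ler_norm (a - b); lra.
Qed.

Context (Phat : probability (vec R Dxi) R) (eps : R).
Hypothesis Phat2 : (second_moment Phat <= Om%:E)%E.

Lemma excess_loss_lip Q Q' x :
  `|excess_loss L Phat eps Q x - excess_loss L Phat eps Q' x| <=
  `|mean Q (loss L x) - mean Q' (loss L x)|.
Proof.
have h Q1 Q2 : excess_loss L Phat eps Q1 x - excess_loss L Phat eps Q2 x <=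
    `|mean Q1 (loss L x) - mean Q2 (loss L x)|.
  apply: le_trans (pos_partB_le _ _) _; rewrite -/(mean Q1 _) -/(mean Q2 _).
  by apply: eqW; congr `|_|; ring.
by rewrite ler_norml h andbT lerNl opprB distrC h.
Qed.

Lemma excess_lossB_le Q x x' : (second_moment Q <= Om%:E)%E ->
  excess_loss L Phat eps Q x - excess_loss L Phat eps Q x' <=
  2 * pwa_opnorm L * (1 + Om) * enorm (x - x').
Proof.
move=> Q2; apply: le_trans (pos_partB_le _ _) _.
rewrite -/(mean Q (loss L x)) -/(mean Q (loss L x')).
rewrite -/(mean Phat (loss L x)) -/(mean Phat (loss L x')).
have h (Q1 : probability (vec R Dxi) R) : (second_moment Q1 <= Om%:E)%E ->
    `|mean Q1 (loss L x) - mean Q1 (loss L x')| <=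
    pwa_opnorm L * (1 + Om) * enorm (x - x').
  move=> Q12; rewrite ler_norml (mean_lossB_le _ _ Q12) andbT lerNl opprB.
  by rewrite -enormN opprB; exact: mean_lossB_le.
have := h _ Q2; have := h _ Phat2.
rewrite !ler_norml => /andP[? ?] /andP[? ?]; apply/andP; split; lra.
Qed.

Lemma excess_loss_measurable Q : (second_moment Q <= Om%:E)%E ->
  measurable_fun setT (excess_loss L Phat eps Q : vec R Dx -> R).
Proof.
move=> Q2; apply: (@lipschitz_measurable _ _ _ (2 * pwa_opnorm L * (1 + Om))).
by move=> x x'; exact: excess_lossB_le.
Qed.

Context (c1 c2 : R) (X : set 'cV[R]_Dx).
Hypotheses (c10 : 0 <= c1) (c20 : 0 <= c2) (eps0 : 0 <= eps).
Hypothesis loss_le : forall x xi, X x -> `|loss L x xi| <= c1 + c2 * enorm xi.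

Lemma norm_mean_loss_le Q x : (second_moment Q <= Om%:E)%E -> X x ->
  `|mean Q (loss L x)| <= c1 + c2 * Num.sqrt Om.
Proof.
move=> Q2 Xx; apply: (norm_mean_le Q2 Om0) => //.
  exact: loss_quadratic_growth.
by move=> xi; exact: loss_le.
Qed.

Lemma excess_loss_le Q x : (second_moment Q <= Om%:E)%E -> X x ->
  excess_loss L Phat eps Q x <= 2 * (c1 + c2 * Num.sqrt Om).
Proof.
move=> Q2 Xx; have := norm_mean_loss_le Phat2 Xx; have := norm_mean_loss_le Q2 Xx.
rewrite !ler_norml => /andP[hQ1 hQ2] /andP[hP1 hP2].
apply: pos_part_le; first by rewrite mulr_ge0// addr_ge0// mulr_ge0// sqrtr_ge0.
rewrite -/(mean Q _) -/(mean Phat _).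
by have := eps0; lra.
Qed.

(** The mean over [xi] of a signed sum of losses is at most its supremum over the
    ball, up to truncation.  The supremum is over all homogeneous vectors of the
    ball, not only those with last coordinate [1]: it then includes [0] and is
    nonnegative, which pays for the part of [Q] outside the ball. *)
Lemma signed_mean_loss_le (K : finType) (x : K -> 'cV[R]_Dx) (t q : R) Q
    (s : seq (K * bool)) :
  (forall k, X (x k)) -> 0 <= t -> 0 < q -> (second_moment Q <= Om%:E)%E ->
  ((1 - q)%:E <= Q [set xi : vec R Dxi | (enorm xi <= t)%R])%E ->
  \sum_(p <- s) sign p.2 * (2 * mean Q (loss L (x p.1))) <=
  rsup (fun v : @centered_ball R (Dxi + 1) (Num.sqrt (t ^+ 2 + 1)) =>
    \sum_(p <- s) sign p.2 * (2 * lmax (loss_dir L (x p.1)) (sval v))) +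
  (size s)%:R * (2 * (c1 * q + c2 * Num.sqrt (q * Om))).
Proof.
move=> xX t0 q0 Q2 Qt; set S := rsup _.
have bS : bounded_family
    (fun v : @centered_ball R (Dxi + 1) (Num.sqrt (t ^+ 2 + 1)) =>
      \sum_(p <- s) sign p.2 * (2 * lmax (loss_dir L (x p.1)) (sval v))).
  apply: bounded_family_sum => p; do 2 apply: bounded_familyZ.
  exists (pwa_opnorm L * Num.sqrt (enorm (x p.1) ^+ 2 + 1) *
    Num.sqrt (t ^+ 2 + 1)) => -[v /= vt].
  apply: le_trans (norm_lmax_le j0 _ (enorm_loss_dir_le L (x p.1))) _.
  by rewrite ler_wpM2l// mulr_ge0 ?sqrtr_ge0 ?(pwa_opnorm_ge0 L j0).
have S0 : 0 <= S.
  have z0 : enorm (0 : 'cV[R]_(Dxi + 1)) <= Num.sqrt (t ^+ 2 + 1).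
    by rewrite enorm0 sqrtr_ge0.
  apply: le_trans (le_rsup (exist _ 0 z0) bS); rewrite big1// => p _ /=.
  by rewrite (lmax0 j0) !mulr0.
pose H (p : K * bool) xi := sign p.2 * (2 * loss L (x p.1) xi).
have qH p : quadratic_growth (H p).
  by do 2 apply: quadratic_growthZ; exact: loss_quadratic_growth.
have -> : \sum_(p <- s) sign p.2 * (2 * mean Q (loss L (x p.1))) =
    mean Q (fun xi => \sum_(p <- s) H p xi).
  rewrite (mean_sum Q2)//; apply: eq_bigr => p _.
  have qL := loss_quadratic_growth (x p.1).
  by rewrite /H (meanZ Q2 _ (quadratic_growthZ 2 qL)) (meanZ Q2).
rewrite mulrA; apply: (mean_truncated_le Q2 (t := t)) => //.
- exact: quadratic_growth_sum.
- move=> xi xit; have zt : enorm (homog xi) <= Num.sqrt (t ^+ 2 + 1).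
    rewrite enorm_homog ler_sqrt ?addr_ge0 ?sqr_ge0// lerD2r.
    by rewrite lerXn2r ?nnegrE ?enorm_ge0.
  apply: le_trans (le_rsup (exist _ (homog xi) zt) bS).
  apply: eqW; apply: eq_bigr => p _.
  by rewrite /H lossE.
- move=> xi; rewrite -[leLHS]add0r; apply: lerD => //.
  elim: {bS S0 S}s => [|p s IH]; first by rewrite big_nil !mul0r.
  rewrite big_cons /= mulrSr mulrDl mul1r mulrDl addrC; apply: lerD => //.
  have := loss_le xi (xX p.1); rewrite ler_norml => /andP[? ?].
  by rewrite /H /sign; case: p.2; lra.
Qed.

End LossMeans.

(** * Deviation of the excess loss *)

(** The bound with a discretization error [2 * e] for arbitrary [e], under the
    assumption that neither the coefficients nor the bound on the mean loss vanish.

    The sampled points are replaced by the representatives of their cells, which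
    makes the sample space finite.  On the good event the deviation of the
    discretized sample is below its threshold; for a distribution in the sampled
    set the excess losses at the sample points vanish, so those at the
    representatives are at most [e], and the mean excess loss is bounded. *)
Lemma sampled_deviation_le (R : realType) (J M Dx Dxi : nat) (L : pwa R J Dx Dxi)
    (X : set 'cV[R]_Dx) (c1 c2 Ksw theta Om eps Rx tau t q e : R)
    (Pstar Phat : probability (vec R Dxi) R) (Z : probability (vec R Dx) R)
    (d : measure_display) (T : measurableType d) (P : probability T R)
    (z : 'I_M -> {RV P >-> vec R Dx}) :
  (0 < J)%N -> (0 < M)%N -> compact X -> 0 <= c1 -> 0 <= c2 ->
  (forall x xi, X x -> `|loss L x xi| <= c1 + c2 * enorm xi) ->
  0 < Om -> (second_moment Phat <= Om%:E)%E -> 0 <= eps ->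
  (second_moment Pstar <= Om%:E)%E -> tail_bound Ksw theta Pstar t ->
  Z X = 1%E -> iid_from z Z -> (forall x, X x -> enorm x <= Rx) ->
  0 < tau <= 1 -> 0 <= t -> 0 < q ->
  2 * expR (- ((t / Ksw) `^ theta)) = q ->
  0 < pwa_opnorm L -> 0 < c1 + c2 * Num.sqrt Om -> 0 < e ->
  holds_with_prob P
    [set w | sampled_set L Phat Om eps Ksw theta t (fun m => z m w)
             `<=` averaged_set L Phat Om eps Ksw theta t Z
      (2 * loss_radius L Rx t * Num.sqrt (J%:R / M%:R) +
       2 * (c1 * q + c2 * Num.sqrt (q * Om)) +
       2 * (c1 + c2 * Num.sqrt Om) * Num.sqrt (1 / (2 * M%:R) * ln (1 / tau)) +
       2 * e)]
    (1 - tau).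
Proof.
move=> J0 M0 cX c10 c20 lossX Om0 Phat2 eps0 Pstar2 Pstart ZX iid XR /andP[tau0 tau1]
  t0 q0 tq op0 c0 e0.
have j0 : 'I_J := Ordinal J0.
have MR : 0 < M%:R :> R by rewrite ltr0n.
have mX : measurable (X : set (vec R Dx)) by exact: compact_measurable.
have [x0 Xx0] := probability1_nonempty ZX.
have Rx0 : 0 <= Rx by apply: le_trans (XR _ Xx0); exact: enorm_ge0.
set op := pwa_opnorm L in op0 *.
pose lip := 2 * op * (1 + Om).
have lip0 : 0 < lip by rewrite !mulr_gt0// addr_gt0.
(* cells so small that the excess loss varies by at most e on each *)
have [K [x [cell [xX mcell cellX]]]] :=
  compact_discretization cX Xx0 (divr_gt0 e0 lip0).
pose p k := fine (Z (cell @^-1` [set k])).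
have pp : prob_weight p := sum_fibers Z mcell.
pose I := {Q : probability (vec R Dxi) R |
  (second_moment Q <= Om%:E)%E /\ tail_bound Ksw theta Q t}.
(* the true distribution belongs to the class, which is therefore not empty *)
pose i0 : I := exist _ Pstar (conj Pstar2 Pstart).
pose f (k : 'I_K.+1) (i : I) := excess_loss L Phat eps (sval i) (x k).
pose F (k : 'I_K.+1) (i : I) := mean (sval i) (loss L (x k)).
pose B := 2 * (c1 + c2 * Num.sqrt Om).
have B0 : 0 < B by rewrite mulr_gt0.
pose U := op * Num.sqrt (Rx ^+ 2 + 1).
have U0 : 0 < U by rewrite mulr_gt0// sqrtr_gt0 ltr_wpDl ?sqr_ge0.
pose rho := Num.sqrt (t ^+ 2 + 1).
pose r := c1 * q + c2 * Num.sqrt (q * Om).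
pose dlt := M%:R * (B * Num.sqrt (1 / (2 * M%:R) * ln (1 / tau))).
pose thr := 2 * rho * U * Num.sqrt (M%:R * J%:R) + M%:R * (2 * r) + dlt.
have ltau0 : 0 <= ln (1 / tau) by rewrite ln_ge0// ler_pdivlMr// mul1r.
have dlt0 : 0 <= dlt by rewrite !mulr_ge0 ?sqrtr_ge0 ?(ltW B0)// ltW.
have lipK y y' (Q : probability (vec R Dxi) R) : (second_moment Q <= Om%:E)%E ->
    enorm (y - y') < e / lip ->
    excess_loss L Phat eps Q y <= excess_loss L Phat eps Q y' + e.
  move=> Q2 yy'; rewrite -lerBlDl.
  apply: le_trans (excess_lossB_le L j0 eps Phat2 y y' Q2) _.
  by rewrite -/lip mulrC -ler_pdivlMr// ltW.
have tail : iidmean p M (fun s => (thr < deviation p f s)%R%:R) <= tau.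
  apply: le_trans (@deviation_tail R _ p I i0 f F J _ (fun k => loss_dir L (x k))
    B U rho r M pp J0 M0 U0 (sqrtr_ge0 _) _ _ _ _ _ dlt B0 dlt0) _.
  - move=> k [Q [Q2 Qt]]; rewrite /f /= pos_part_ge0/=.
    exact: (excess_loss_le j0 Om0 Phat2 c10 c20 eps0 lossX).
  - move=> k; exists (c1 + c2 * Num.sqrt Om) => -[Q [Q2 Qt]].
    exact: (norm_mean_loss_le j0 Om0 c20 lossX Q2).
  - move=> k [Q ?] [Q' ?]; exact: excess_loss_lip.
  - move=> k j; apply: le_trans (enorm_loss_dir_le L (x k) j) _.
    rewrite ler_wpM2l ?(ltW op0)// ler_sqrt ?addr_ge0 ?sqr_ge0// lerD2r.
    by rewrite lerXn2r ?nnegrE ?enorm_ge0// XR.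
  - move=> s [Q [Q2 Qt]]; apply: (signed_mean_loss_le j0 Om0 c10 c20 lossX) => //.
    by rewrite -tq.
  rewrite /dlt exprMn exprMn sqr_sqrtr; last first.
    by rewrite mulr_ge0// divr_ge0// mulr_ge0// ltW.
  have -> : 2 * (M%:R ^+ 2 * (B ^+ 2 * (1 / (2 * M%:R) * ln (1 / tau)))) /
      (M%:R * B ^+ 2) = ln (1 / tau).
    by field; rewrite !gt_eqF.
  by rewrite expRN lnK ?posrE ?divr_gt0// invf_div divr1.
pose sample w := [tuple cell (z m w) | m < M].
have [mbad Pbad] := iid_discrete_law (fun s => (thr < deviation p f s)%R) mcell iid.
pose bad := [set w | (thr < deviation p f (sample w))%R].
pose inX := [set w | forall m, m \in [set: 'I_M]%SET -> X (z m w)].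
have minX : measurable inX.
  rewrite (_ : inX = \bigcap_(m in [set: 'I_M]) (z m @^-1` X)).
    apply: fin_bigcap_measurable => // m _.
    by rewrite -[X in measurable X]setTI; apply: measurable_funP.
  by apply/seteqP; split => w /= H m => [_|_]; apply: H; rewrite ?inE.
have PinX : P inX = 1%E.
  rewrite /inX (iid.2 [set: 'I_M]%SET (fun=> X))//.
  by rewrite big1// => m _; rewrite -ZX -(iid.1 m).
exists (inX `\` bad); split.
- exact: measurableD.
- move=> w [/= wX /negP wbad] Q [Qs Q2 Qt]; split => //.
  have {}wX m : X (z m w) by apply: wX; rewrite inE.
  pose i : I := exist _ Q (conj Q2 Qt).
  have fz m : excess_loss L Phat eps Q (z m w) <= 0.
    move: Qs; rewrite pmulr_rle0 ?invr_gt0// => /(le_trans _); apply.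
    by rewrite (bigD1 m)//= lerDl sumr_ge0// => k _; exact: pos_part_ge0.
  have dev : M%:R * fmean p (f^~ i) <= thr + M%:R * e.
    have f0B k j : 0 <= f k j <= B.
      case: j => Q' [Q'2 Q't]; rewrite /f /= pos_part_ge0/=.
      exact: (excess_loss_le j0 Om0 Phat2 c10 c20 eps0 lossX).
    have := le_deviation pp f0B (sample w) i.
    rewrite sumrB big_const_seq count_predT size_tuple iter_addr_0 => dev.
    have fe : \sum_(k <- sample w) f k i <= M%:R * e.
      rewrite big_tuple mulr_natl -[X in _ *+ X]card_ord -sumr_const.
      apply: ler_sum => m _; rewrite tnth_mktuple /f /=.
      apply: le_trans (lipK _ (z m w) Q Q2 _) _; last by rewrite gerDr fz.
      by rewrite -enormN opprB; exact: cellX.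
    move: wbad; rewrite ltNge negbK => wbad; rewrite mulr_natl.
    lra.
  apply: le_trans (expectation_le_fibers (x := x) mcell mX ZX
    (excess_loss_measurable L j0 eps Phat2 Q2) _ (ltW e0) _) _.
  + by move=> y; exact: pos_part_ge0.
  + by move=> y Xy; apply: lipK => //; exact: cellX.
  rewrite lee_fin -(ler_pM2l MR) mulrDr.
  apply: le_trans (lerD dev (lexx _)) _.
  have sqrtE : Num.sqrt (M%:R * J%:R) = M%:R * Num.sqrt (J%:R / M%:R) :> R.
    have -> : M%:R * J%:R = M%:R ^+ 2 * (J%:R / M%:R) :> R.
      by field; rewrite gt_eqF.
    by rewrite sqrtrM ?sqr_ge0// sqrtr_sqr gtr0_norm.
  have -> : loss_radius L Rx t = op * rho * Num.sqrt (Rx ^+ 2 + 1) by [].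
  rewrite /thr sqrtE /dlt /B /U /r.
  by apply: eqW; ring.
- have PbadC : ((1 - tau)%:E <= P (~` bad))%E.
    rewrite probability_setC// Pbad -EFinB lee_fin lerD2l lerN2.
    exact: tail.
  apply: (le_trans PbadC).
  have mbadC : measurable (~` bad) by exact: measurableC.
  have mI : measurable (~` bad `&` inX) by exact: measurableI.
  have mD : measurable (~` bad `&` ~` inX).
    by apply: measurableI => //; exact: measurableC.
  have PD0 : (P (~` bad `&` ~` inX) = 0)%E.
    apply/eqP; rewrite eq_le measure_ge0 andbT.
    apply: (@le_trans _ _ (P (~` inX))).
      by apply: le_measure; rewrite ?inE//; exact: measurableC.
    by rewrite probability_setC// PinX subee.
  rewrite -[~` bad](setIT) -(setUv inX) setIUr.
  apply: (@le_trans _ _ (P (~` bad `&` inX) + P (~` bad `&` ~` inX))%E).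
    exact: measureU2.
  by rewrite PD0 adde0 setIC -setDE.
Qed.

(** * Threshold, constant and degenerate cases *)

(** The threshold is chosen for this: the tail condition then leaves a mass of at
    most [2 / M] outside the ball. *)
Lemma log_thresholdK (R : realType) (Ksw theta : R) (M : nat) :
  (2 <= M)%N -> 0 < Ksw -> 0 < theta ->
  2 * expR (- ((log_threshold Ksw theta M / Ksw) `^ theta)) = 2 / M%:R.
Proof.
move=> M2 K0 th0; have MR : 0 < M%:R :> R by rewrite ltr0n (leq_trans _ M2).
have -> : log_threshold Ksw theta M / Ksw = ln M%:R `^ (1 / theta).
  by rewrite mulrC mulKf ?gt_eqF.
rewrite -powRrM mul1r mulVf ?gt_eqF//.
rewrite powRr1; last by rewrite ln_ge0// ler1n (leq_trans _ M2).
by rewrite expRN lnK.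
Qed.

Lemma log_threshold_gt0 (R : realType) (Ksw theta : R) (M : nat) :
  (2 <= M)%N -> 0 < Ksw -> 0 < log_threshold Ksw theta M.
Proof.
by move=> M2 K0; rewrite mulr_gt0// powR_gt0// ln_gt0// ltr1n.
Qed.

(** The logarithmic factors only have to be bounded below, by their values at
    [J = M = 2]; this fixes the absolute constant. *)
Lemma ln_factor_le (R : realType) (J M : nat) : (2 <= J)%N -> (2 <= M)%N ->
  3 * Num.sqrt (J%:R / M%:R) <=
  3 / ln 2 ^+ 2 * Num.sqrt (J%:R * ln J%:R * ln M%:R ^+ 3 / M%:R) :> R.
Proof.
move=> J2 M2; have l2 : 0 < ln 2 :> R by rewrite ln_gt0// ltr1n.
have lnn (n : nat) : (2 <= n)%N -> ln 2 <= ln n%:R :> R.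
  move=> n2; have n0 : 0 < n%:R :> R by rewrite ltr0n (leq_trans _ n2).
  by rewrite ler_ln ?posrE// ler_nat.
have JM0 : 0 <= J%:R / M%:R :> R by rewrite divr_ge0.
rewrite -mulrA ler_pM2l// ler_pdivlMl ?exprn_gt0//.
rewrite -[X in X * _]ger0_norm ?sqr_ge0// -sqrtr_sqr -sqrtrM ?sqr_ge0//.
have -> : J%:R * ln J%:R * ln M%:R ^+ 3 / M%:R =
  ln J%:R * ln M%:R ^+ 3 * (J%:R / M%:R) :> R by ring.
have lM0 : 0 < ln M%:R :> R := lt_le_trans l2 (lnn _ M2).
have lJ0 : 0 < ln J%:R :> R := lt_le_trans l2 (lnn _ J2).
rewrite ler_sqrt; last by rewrite mulr_ge0// mulr_ge0 ?exprn_ge0// ltW.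
have -> : (ln 2 ^+ 2) ^+ 2 = ln 2 * ln 2 ^+ 3 :> R by ring.
rewrite ler_wpM2r//; apply: ler_pM; [exact: ltW| |exact: lnn|].
  by apply: exprn_ge0; exact: ltW.
by rewrite lerXn2r ?nnegrE ?lnn// ltW.
Qed.

(** The degenerate cases, in which every mean excess loss is zero. *)
Lemma averaged_set_full (R : realType) (J Dx Dxi : nat) (L : pwa R J Dx Dxi)
    (X : set 'cV[R]_Dx) (Om eps Ksw theta t eta : R)
    (Phat : probability (vec R Dxi) R) (Z : probability (vec R Dx) R)
    (M : nat) (A : 'I_M -> 'cV[R]_Dx) :
  (0 < J)%N -> (second_moment Phat <= Om%:E)%E ->
  measurable (X : set (vec R Dx)) -> Z X = 1%E -> 0 <= eta ->
  (forall Q x, (second_moment Q <= Om%:E)%E -> X x ->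
    excess_loss L Phat eps Q x <= 0) ->
  sampled_set L Phat Om eps Ksw theta t A
  `<=` averaged_set L Phat Om eps Ksw theta t Z eta.
Proof.
move=> J0 Phat2 mX ZX eta0 ex0 Q [_ Q2 Qt]; split => //.
have [x0 Xx0] := probability1_nonempty ZX.
have cellT (k : unit) : measurable ((fun _ : vec R Dx => tt) @^-1` [set k]).
  by rewrite (_ : _ @^-1` _ = setT)//; apply/seteqP; split => // y _; case: k.
apply: le_trans (expectation_le_fibers (x := fun=> x0) cellT mX ZX
  (excess_loss_measurable L (Ordinal J0) eps Phat2 Q2) _ (lexx 0) _) _.
- by move=> y; exact: pos_part_ge0.
- by move=> y Xy; rewrite addr0 (le_trans (ex0 Q y Q2 Xy))// pos_part_ge0.
rewrite lee_fin addr0; apply: le_trans eta0.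
have pw := sum_fibers Z cellT.
rewrite -[leRHS](fmean_cst pw); apply: le_fmean => // k.
exact: ex0.
Qed.

Theorem theorem6 (R : realType) :
  exists C : R, 0 < C /\
  forall (J M Dx Dxi N : nat) (L : pwa R J Dx Dxi) (X : set 'cV[R]_Dx)
    (c1 c2 Ksw theta Om eps Rx tau : R)
    (Pstar Phat : probability (vec R Dxi) R) (xihat : 'I_N -> vec R Dxi)
    (Z : probability (vec R Dx) R)
    (d : measure_display) (T : measurableType d) (P : probability T R)
    (z : 'I_M -> {RV P >-> vec R Dx}),
  (2 <= J)%N -> (2 <= M)%N -> (0 < N)%N ->
  compact X -> convex_set (X : set (convex_lmodType 'cV[R]_Dx)) ->
  0 <= c1 -> 0 <= c2 ->
  (forall x xi, X x -> `|loss L x xi| <= c1 + c2 * enorm xi) ->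
  0 < Ksw -> 0 < theta ->
  (forall t, 0 < t -> tail_bound Ksw theta Pstar t) ->
  is_empirical xihat Phat ->
  (second_moment Phat < Om%:E)%E ->
  (second_moment Pstar <= Om%:E)%E ->
  0 <= eps ->
  full_support_on X Z ->
  iid_from z Z ->
  (forall x, X x -> enorm x <= Rx) ->
  0 < tau < 1 ->
  let tM := log_threshold Ksw theta M in
  let etaM := eta_bound C L Rx Ksw theta c1 c2 Om M tau in
  holds_with_prob P
    [set w | sampled_set L Phat Om eps Ksw theta tM (fun m => z m w)
             `<=` averaged_set L Phat Om eps Ksw theta tM Z etaM]
    (1 - tau).
Proof.
have l2 : 0 < ln 2 :> R by rewrite ln_gt0// ltr1n.
exists (3 / ln 2 ^+ 2); split; first by rewrite divr_gt0 ?exprn_gt0.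
move=> J M Dx Dxi N L X c1 c2 Ksw theta Om eps Rx tau Pstar Phat xihat Z d T P z.
move=> J2 M2 _ cX _ c10 c20 lossX K0 th0 Pstart _ Phat_lt Pstar2 eps0 [ZX _] iid XR.
move=> /andP[tau0 tau1] tM etaM.
have J0 : (0 < J)%N by exact: ltnW.
have M0 : (0 < M)%N by exact: ltnW.
have MR : 0 < M%:R :> R by rewrite ltr0n.
have j0 : 'I_J := Ordinal J0.
have Phat2 := ltW Phat_lt.
have Om0 : 0 < Om.
  rewrite -lte_fin; apply: le_lt_trans Phat_lt.
  by rewrite second_momentE integral_ge0// => xi _; rewrite lee_fin sqr_ge0.
have mX : measurable (X : set (vec R Dx)) by exact: compact_measurable.
have tM0 : 0 < tM by exact: log_threshold_gt0.
have op0 := pwa_opnorm_ge0 L j0.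
have lr0 : 0 <= loss_radius L Rx tM by rewrite !mulr_ge0 ?sqrtr_ge0.
have sOm0 : 0 <= c1 + c2 * Num.sqrt Om by rewrite addr_ge0// mulr_ge0 ?sqrtr_ge0.
set b := 2 * (c1 + c2 * Num.sqrt Om) *
  Num.sqrt (1 / (2 * M%:R) * ln (1 / tau)).
set r := 2 * (c1 * (2 / M%:R) + c2 * Num.sqrt (2 / M%:R * Om)).
have b0 : 0 <= b by rewrite !mulr_ge0 ?sqrtr_ge0.
have r0 : 0 <= r by rewrite mulr_ge0// addr_ge0// mulr_ge0 ?sqrtr_ge0// divr_ge0.
have etaE : 3 * loss_radius L Rx tM * Num.sqrt (J%:R / M%:R) + b + r <= etaM.
  rewrite /etaM /eta_bound -/tM -/b.
  have -> : 2 * Om / M%:R = 2 / M%:R * Om by ring.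
  have := ler_wpM2l lr0 (ln_factor_le R J2 M2).
  have -> : r = 4 * c1 / M%:R + 2 * c2 * Num.sqrt (2 / M%:R * Om).
    by rewrite /r; ring.
  by lra.
have eta0 : 0 <= etaM.
  by apply: le_trans etaE; rewrite !addr_ge0// !mulr_ge0 ?sqrtr_ge0.
have full : (forall Q x, (second_moment Q <= Om%:E)%E -> X x ->
    excess_loss L Phat eps Q x <= 0) ->
  holds_with_prob P
    [set w | sampled_set L Phat Om eps Ksw theta tM (fun m => z m w)
             `<=` averaged_set L Phat Om eps Ksw theta tM Z etaM] (1 - tau).
  move=> ex0; exists setT; split => //.
    by move=> w _; exact: (averaged_set_full J0 Phat2 mX ZX eta0 ex0).
  by rewrite probability_setT lee_fin gerBl ltW.
have [opE|opn0] := eqVneq (pwa_opnorm L) 0.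
  (* all coefficients vanish, hence so does the loss *)
  apply: full => Q x _ _; have lossE0 : loss L x = cst 0.
    apply/funext => xi; apply/eqP; rewrite -normr_le0.
    by apply: le_trans (norm_loss_le L j0 x xi) _; rewrite opE !mul0r.
  apply: pos_part_le => //; rewrite -/(mean Q (loss L x)) -/(mean Phat (loss L x)).
  by rewrite lossE0 !mean_cst; lra.
have [BE|Bn0] := eqVneq (c1 + c2 * Num.sqrt Om) 0.
  apply: full => Q x Q2 Xx.
  apply: le_trans (excess_loss_le j0 Om0 Phat2 c10 c20 eps0 lossX Q2 Xx) _.
  by rewrite BE mulr0.
have oppos : 0 < pwa_opnorm L by rewrite lt_def opn0.
have Bpos : 0 < c1 + c2 * Num.sqrt Om by rewrite lt_def Bn0.
(* the complexity term uses two of the three units; e spends the third *)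
pose e := loss_radius L Rx tM * Num.sqrt (J%:R / M%:R) / 2.
have sq1 (a : R) : 0 < Num.sqrt (a ^+ 2 + 1) by rewrite sqrtr_gt0 ltr_wpDl ?sqr_ge0.
have e0 : 0 < e.
  by rewrite divr_gt0// mulr_gt0 ?sqrtr_gt0 ?divr_gt0 ?ltr0n// !mulr_gt0.
have q0 : 0 < 2 / M%:R :> R by rewrite divr_gt0.
have tau01 : 0 < tau <= 1 by rewrite tau0 ltW.
have [E [mE Esub PE]] := sampled_deviation_le J0 M0 cX c10 c20 lossX Om0 Phat2 eps0
  Pstar2 (Pstart tM tM0) ZX iid XR tau01 (ltW tM0) q0
  (log_thresholdK M2 K0 th0) oppos Bpos e0.
exists E; split => // w /Esub /= sub Q /sub [EQ Q2 Qt]; split => //.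
apply: le_trans EQ _; rewrite lee_fin; apply: le_trans etaE.
by rewrite -/b -/r /e; lra.
Qed.
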